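(* Let $N^{2n+1}(c)$ be a Sasakian space form with constant $\varphi$-sectional curvature $c\leq\frac{3-3n}{n+3}$. Then an $n$-dimensional integral submanifold $M^{n}$ of $N^{2n+1}(c)$ with constant mean curvature $|H|$ is biharmonic if and only if it is minimal.
   Context: Everything is smooth; manifolds are connected. A contact metric structure on $N^{2n+1}$ is $(\varphi,\xi,\eta,g)$ with $\varphi$ a $(1,1)$-tensor field, $\xi$ a vector field, $\eta$ a 1-form, $g$ a Riemannian metric such that $\varphi^2=-I+\eta\otimes\xi$, $\eta(\xi)=1$, $g(\varphi U,\varphi V)=g(U,V)-\eta(U)\eta(V)$, $g(U,\varphi V)=d\eta(U,V)$. It is Sasakian if $(\nabla^N_U\varphi)(V)=g(U,V)\xi-\eta(V)U$ for all vector fields $U,V$; then $\nabla^N_U\xi=-\varphi U$. The $\varphi$-sectional curvature is the sectional curvature of the planes spanned by $U,\varphi U$ with $U$ a unit vector orthogonal to $\xi$; a Sasakian space form $N(c)$ is a Sasakian manifold with constant $\varphi$-sectional curvature $c$. An integral submanifold $M$ of $N$ is a submanifold (with induced metric) with $\eta(X)=0$ for all $X$ tangent to $M$. $H=\frac1n\operatorname{trace}B$ is its mean curvature vector field, $B$ being the second fundamental form; $M$ is minimal if $H=0$. A map $\psi:(M,g)\to(N,h)$ is biharmonic if it is a critical point of the bienergy $E_2(\psi)=\frac12\int_M|\tau(\psi)|^2v_g$, $\tau(\psi)=\operatorname{trace}\nabla d\psi$; equivalently $\tau_2(\psi)=-\Delta\tau(\psi)-\operatorname{trace}R^N(d\psi,\tau(\psi))d\psi=0$,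 with $\Delta=-\operatorname{trace}\nabla^2$ the rough Laplacian. A submanifold is biharmonic if its inclusion map is biharmonic. *)

(* Defs.v *)
From HB Require Import structures.
From mathcomp Require Import all_boot all_order all_algebra.
From mathcomp Require Import all_classical all_reals all_analysis.

Set Implicit Arguments.
Unset Strict Implicit.
Unset Printing Implicit Defensive.

Import Order.TTheory GRing.Theory Num.Theory.
Import numFieldNormedType.Exports.

Local Open Scope classical_set_scope.
Local Open Scope ring_scope.

(* Points and tangent vectors are row vectors of coordinates.  Tensors act on
   the right: a (1,1)-tensor P sends v to v *m P, a 1-form w (a column) sends v
   to the entry of v *m w, and the Jacobian of f sends v to v *m 'J f x. *)

Section Calculus.
Context {R : realType}.

Definition basisv (d : nat) (i : 'I_d) : 'rV[R]_d := delta_mx 0 i.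

Definition partials (d : nat) (V : normedModType R) (f : 'rV[R]_d -> V)
    (s : seq 'I_d) : 'rV[R]_d -> V :=
  foldr (fun i h => 'D_(basisv i) h) f s.

(* C^oo on an open set U: differentiability of all iterated partial derivatives
   makes all of them continuous. *)
Definition smooth_on (d : nat) (V : normedModType R) (U : set 'rV[R]_d)
    (f : 'rV[R]_d -> V) : Prop :=
  forall (s : seq 'I_d) (x : 'rV[R]_d), U x -> differentiable (partials f s) x.

Definition bil (d : nat) (A : 'M[R]_d) (u v : 'rV[R]_d) : R :=
  (u *m A *m v^T) 0 0.

Definition pairing (d : nat) (w : 'cV[R]_d) (v : 'rV[R]_d) : R := (v *m w) 0 0.

Definition mtrace (d : nat) (V : lmodType R) (h : 'M[R]_d)
    (T : 'rV[R]_d -> 'rV[R]_d -> V) : V :=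
  \sum_i \sum_j (invmx h) i j *: T (basisv i) (basisv j).

End Calculus.

(* Riemannian geometry in one coordinate system, where G : 'rV_d -> 'M_d is the
   matrix of the metric.  A vector u also stands for the coordinate vector field
   with constant components u; such fields commute. *)
Section LocalGeometry.
Context {R : realType} {d : nat}.
Implicit Types (G : 'rV[R]_d -> 'M[R]_d) (x u v w : 'rV[R]_d).

(* Koszul: 2 g(Gamma(u, v), e_k) = u g(v, e_k) + v g(u, e_k) - e_k g(u, v). *)
Definition christoffel G x u v : 'rV[R]_d :=
  (\row_k (2^-1 * (bil ('D_u G x) v (basisv k) + bil ('D_v G x) u (basisv k)
                   - bil ('D_(basisv k) G x) u v))) *m invmx (G x).

Definition nabla G u (V : 'rV[R]_d -> 'rV[R]_d) x : 'rV[R]_d :=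
  'D_u V x + christoffel G x u (V x).

(* R(X, Y)Z = nabla_X nabla_Y Z - nabla_Y nabla_X Z - nabla_[X, Y] Z. *)
Definition curvature G x u v w : 'rV[R]_d :=
  nabla G u (nabla G v (cst w)) x - nabla G v (nabla G u (cst w)) x.

Definition sectional G x u v : R :=
  bil (G x) (curvature G x u v v) u /
  (bil (G x) u u * bil (G x) v v - bil (G x) u v ^+ 2).

(* (nabla_U phi)(V) = nabla_U (phi V) - phi (nabla_U V), a tensor in U, V. *)
Definition nabla_endo G (phi : 'rV[R]_d -> 'M[R]_d) x u v : 'rV[R]_d :=
  nabla G u (fun y => v *m phi y) x - nabla G u (cst v) x *m phi x.

(* d eta(U, V) = 1/2 (U eta(V) - V eta(U) - eta([U, V])): the factor 1/2 is the
   one for which g(U, phi V) = d eta(U, V) is compatible with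
   nabla_U xi = - phi U. *)
Definition ext_deriv (eta : 'rV[R]_d -> 'cV[R]_d) x u v : R :=
  2^-1 * (pairing ('D_u eta x) v - pairing ('D_v eta x) u).

End LocalGeometry.

(* A map F in coordinates, from dimension m with metric matrix h to dimension d
   with metric matrix G. *)
Section LocalMaps.
Context {R : realType} {m d : nat}.
Variables (h : 'rV[R]_m -> 'M[R]_m) (G : 'rV[R]_d -> 'M[R]_d).
Variable F : 'rV[R]_m -> 'rV[R]_d.
Implicit Types (x u v : 'rV[R]_m).

(* The pull-back connection on vector fields along F. *)
Definition nabla_along u (V : 'rV[R]_m -> 'rV[R]_d) x : 'rV[R]_d :=
  'D_u V x + christoffel G (F x) ('D_u F x) (V x).

(* (nabla dF)(u, v) = nabla_u (dF v) - dF (nabla_u v). *)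
Definition hess_map x u v : 'rV[R]_d :=
  nabla_along u ('D_v F) x - 'D_(nabla h u (cst v) x) F x.

Definition tension x : 'rV[R]_d := mtrace (h x) (hess_map x).

(* (nabla^2 V)(u, v) = nabla_u nabla_v V - nabla_(nabla_u v) V. *)
Definition hess_along (V : 'rV[R]_m -> 'rV[R]_d) x u v : 'rV[R]_d :=
  nabla_along u (nabla_along v V) x - nabla_along (nabla h u (cst v) x) V x.

Definition rough_laplacian (V : 'rV[R]_m -> 'rV[R]_d) x : 'rV[R]_d :=
  - mtrace (h x) (hess_along V x).

Definition bitension x : 'rV[R]_d :=
  - rough_laplacian tension x
  - mtrace (h x) (fun u v =>
      curvature G (F x) ('D_u F x) (tension x) ('D_v F x)).

(* For an isometric immersion F: orthogonal projection of w, a tangent vector of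
   the target at F x, on the image of dF. *)
Definition tangent_part x (w : 'rV[R]_d) : 'rV[R]_d :=
  mtrace (h x) (fun u v => bil (G (F x)) w ('D_u F x) *: 'D_v F x).

Definition second_fund x u v : 'rV[R]_d :=
  nabla_along u ('D_v F) x - tangent_part x (nabla_along u ('D_v F) x).

Definition mean_curv x : 'rV[R]_d := m%:R^-1 *: mtrace (h x) (second_fund x).

End LocalMaps.

(* Connected smooth manifolds, given by a smooth atlas; chart a is the
   homeomorphism coord a from dom a to its image, with inverse param a. *)
Record manifold (R : realType) (d : nat) := Manifold {
  carrier :> topologicalType;
  chart : Type;
  dom : chart -> set carrier;
  coord : chart -> carrier -> 'rV[R]_d;
  param : chart -> 'rV[R]_d -> carrier;
  carrier_hausdorff : hausdorff_space carrier;
  carrier_second_countable : @second_countable carrier;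
  carrier_connected : connected [set: carrier];
  dom_open : forall a, open (dom a);
  dom_cover : forall p, exists a, dom a p;
  coord_open : forall a, open (coord a @` dom a);
  coordK : forall a p, dom a p -> param a (coord a p) = p;
  coord_continuous : forall a p, dom a p -> {for p, continuous (coord a)};
  param_continuous : forall a x, (coord a @` dom a) x ->
    {for x, continuous (param a)};
  transition_smooth : forall a b,
    smooth_on (coord a @` (dom a `&` dom b)) (coord b \o param a)
}.

Section Manifolds.
Context {R : realType}.

Definition chart_img (d : nat) (M : manifold R d) (a : chart M) : set 'rV[R]_d :=
  coord a @` dom a.

Definition overlap (d : nat) (M : manifold R d) (a b : chart M) :
    set 'rV[R]_d :=
  coord a @` (dom a `&` dom b).

Definition transition (d : nat) (M : manifold R d) (a b : chart M) :
    'rV[R]_d -> 'rV[R]_d :=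
  coord b \o param a.

(* Tensor fields are given by their components in each chart of the atlas. *)

Record riemannian_metric (d : nat) (M : manifold R d) := RiemannianMetric {
  metric :> chart M -> 'rV[R]_d -> 'M[R]_d;
  metric_smooth : forall a, smooth_on (chart_img a) (metric a);
  metric_sym : forall a x, chart_img a x -> (metric a x)^T = metric a x;
  metric_pos : forall a x u, chart_img a x -> u != 0 ->
    0 < bil (metric a x) u u;
  metric_change : forall a b x, overlap a b x ->
    let J := 'J (transition a b) x in
    metric a x = J *m metric b (transition a b x) *m J^T
}.

Record contact_metric (n : nat) (N : manifold R (2 * n).+1) := ContactMetric {
  cphi : chart N -> 'rV[R]_((2 * n).+1) -> 'M[R]_((2 * n).+1);
  cxi : chart N -> 'rV[R]_((2 * n).+1) -> 'rV[R]_((2 * n).+1);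
  ceta : chart N -> 'rV[R]_((2 * n).+1) -> 'cV[R]_((2 * n).+1);
  cmetric : riemannian_metric N;
  cphi_smooth : forall a, smooth_on (chart_img a) (cphi a);
  cxi_smooth : forall a, smooth_on (chart_img a) (cxi a);
  ceta_smooth : forall a, smooth_on (chart_img a) (ceta a);
  cphi_change : forall a b x, overlap a b x ->
    let J := 'J (transition a b) x in
    cphi a x *m J = J *m cphi b (transition a b x);
  cxi_change : forall a b x, overlap a b x ->
    let J := 'J (transition a b) x in
    cxi b (transition a b x) = cxi a x *m J;
  ceta_change : forall a b x, overlap a b x ->
    let J := 'J (transition a b) x in
    ceta a x = J *m ceta b (transition a b x);
  cphi_sqr : forall a x v, chart_img a x ->
    v *m cphi a x *m cphi a x = - v + pairing (ceta a x) v *: cxi a x;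
  ceta_xi : forall a x, chart_img a x -> pairing (ceta a x) (cxi a x) = 1;
  cmetric_phi : forall a x u v, chart_img a x ->
    bil (cmetric a x) (u *m cphi a x) (v *m cphi a x) =
    bil (cmetric a x) u v - pairing (ceta a x) u * pairing (ceta a x) v;
  cmetric_deta : forall a x u v, chart_img a x ->
    bil (cmetric a x) u (v *m cphi a x) = ext_deriv (ceta a) x u v
}.

Definition sasakian (n : nat) (N : manifold R (2 * n).+1)
    (S : contact_metric N) : Prop :=
  forall (a : chart N) (x u v : 'rV[R]_((2 * n).+1)), chart_img a x ->
    nabla_endo (cmetric S a) (cphi S a) x u v =
    bil (cmetric S a x) u v *: cxi S a x - pairing (ceta S a x) v *: u.

Definition const_phi_sectional (n : nat) (N : manifold R (2 * n).+1)
    (S : contact_metric N) (c : R) : Prop :=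
  forall (a : chart N) (x u : 'rV[R]_((2 * n).+1)), chart_img a x ->
    bil (cmetric S a x) u u = 1 -> bil (cmetric S a x) u (cxi S a x) = 0 ->
    sectional (cmetric S a) x u (u *m cphi S a x) = c.

Definition sasakian_space_form (n : nat) (N : manifold R (2 * n).+1)
    (S : contact_metric N) (c : R) : Prop :=
  sasakian S /\ const_phi_sectional S c.

Section Maps.
Context {m d : nat} {M : manifold R m} {N : manifold R d}.
Implicit Types (f : M -> N) (a : chart M) (b : chart N).

Definition map_dom f a b : set 'rV[R]_m :=
  coord a @` (dom a `&` f @^-1` dom b).

Definition map_coord f a b : 'rV[R]_m -> 'rV[R]_d := coord b \o f \o param a.

Definition smooth_map f : Prop :=
  continuous f /\ forall a b, smooth_on (map_dom f a b) (map_coord f a b).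

Definition immersion f : Prop :=
  forall a b x u, map_dom f a b x -> 'D_u (map_coord f a b) x = 0 -> u = 0.

(* f is the inclusion map of a submanifold. *)
Definition submanifold f : Prop :=
  [/\ smooth_map f, immersion f & injective f].

Variables (h : riemannian_metric M) (g : riemannian_metric N).

Definition induced_metric f : Prop :=
  forall a b x u v, map_dom f a b x ->
    bil (h a x) u v =
    bil (g b (map_coord f a b x))
      ('D_u (map_coord f a b) x) ('D_v (map_coord f a b) x).

(* The Euler-Lagrange equation tau_2(f) = 0 of the bienergy. *)
Definition biharmonic f : Prop :=
  forall a b x, map_dom f a b x ->
    bitension (h a) (g b) (map_coord f a b) x = 0.

Definition minimal f : Prop :=
  forall a b x, map_dom f a b x ->
    mean_curv (h a) (g b) (map_coord f a b) x = 0.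

Definition constant_mean_curvature f : Prop :=
  exists k : R, forall a b x, map_dom f a b x ->
    let H := mean_curv (h a) (g b) (map_coord f a b) x in
    Num.sqrt (bil (g b (map_coord f a b x)) H H) = k.

End Maps.

Definition integral_submanifold (m n : nat) (M : manifold R m)
    (N : manifold R (2 * n).+1) (S : contact_metric N) (f : M -> N) : Prop :=
  submanifold f /\
  forall (a : chart M) (b : chart N) (x u : 'rV[R]_m), map_dom f a b x ->
    pairing (ceta S b (map_coord f a b x)) ('D_u (map_coord f a b) x) = 0.

End Manifolds.

(* Main.v *)
(* Write tau for the tension field n H.  If |tau| is constant, pairing the
   biharmonic equation with tau gives
     sum_i |nabla_i tau|^2 = sum_i <R(e_i, tau) tau, e_i>
   in an orthonormal frame e_i of M.  Since M is a Legendre submanifold, the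
   tangent space of N along M is the orthogonal sum of TM, phi TM and R xi; as
   tau is orthogonal to TM and xi, it is phi z for some z tangent to M.  The
   curvature of a Sasakian space form then turns the right-hand side into
   (c (n + 3) + 3 n - 3) / 4 |z|^2, which is nonpositive, whereas
   <nabla_i tau, xi> = <tau, phi e_i> = <z, e_i> bounds the left-hand side from
   below by |z|^2.  Hence z = 0.

   The curvature of a Sasakian space form minus that of the unit sphere is a
   Kaehler curvature tensor on the contact distribution, with constant
   holomorphic sectional curvature c - 1: polarisation determines its sectional
   curvatures. *)

(* Nothing is integrated: constancy of |tau| makes every <nabla_w tau, tau> vanish, and one more
   derivative trades <nabla^2 tau, tau> for the products of first derivatives, point by point. The
   argument is therefore local, on one pair of charts, where constant vectors serve as commuting
   fields and an orthonormal frame is needed only at the point considered.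

   The space form hypothesis prescribes the curvature of phi-planes only. Rather than the whole
   curvature tensor, the one value that occurs is derived: for horizontal u, v with g(u, phi v) = 0,
   <R(u, phi v) phi v, u> is ((c + 3) |u|^2 |v|^2 + 3 (c - 1) g(u, v)^2) / 4. With u = e_i, v = z,
   summing over i gives n (c + 3) + 3 (c - 1) = c (n + 3) + 3 n - 3, the origin of the threshold on
   c. At the threshold this sum is zero, and it is the xi-component of nabla tau, of total square
   |z|^2, that still forces z = 0. *)
Require Import Defs.
From HB Require Import structures.
From mathcomp Require Import all_boot all_order all_algebra.
From mathcomp Require Import all_classical all_reals all_analysis.
From mathcomp Require Import ring lra.

Import Order.TTheory GRing.Theory Num.Theory.
Import numFieldNormedType.Exports.
Local Open Scope ring_scope.
Set Implicit Arguments.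
Unset Strict Implicit.
Unset Printing Implicit Defensive.
Local Open Scope classical_set_scope.

(** * Smoothness *)

Section Smoothness.
Context {R : realType}.
Implicit Types V W : normedModType R.

(* Derivatives are taken along all constant vectors, not only the basis ones of
   [smooth_on], so that [smooth] makes sense on any normed module. *)
Fixpoint smooth_upto (k : nat) V W (U : set V) (f : V -> W) : Prop :=
  match k with
  | 0 => forall x, U x -> differentiable f x
  | j.+1 => (forall x, U x -> differentiable f x) /\
            forall v, smooth_upto j U ('D_v f)
  end.

Definition smooth V W (U : set V) (f : V -> W) : Prop :=
  forall k, smooth_upto k U f.

Lemma smooth_upto_differentiable k V W (U : set V) (f : V -> W) x :
  smooth_upto k U f -> U x -> differentiable f x.
Proof. by case: k => [|k] /= => [sf|[sf _]] Ux; exact: sf. Qed.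

Lemma smooth_upto_pred k V W (U : set V) (f : V -> W) :
  smooth_upto k.+1 U f -> smooth_upto k U f.
Proof.
elim: k f => [|k IHk] f; first by case.
by move=> [df Df]; split=> // v; apply: IHk (Df v).
Qed.

Lemma smooth_differentiable V W (U : set V) (f : V -> W) x :
  smooth U f -> U x -> differentiable f x.
Proof. by move=> /(_ 0%N); apply: smooth_upto_differentiable. Qed.

Lemma smooth_derivable V W (U : set V) (f : V -> W) x v :
  smooth U f -> U x -> derivable f x v.
Proof. by move=> sf Ux; apply/diff_derivable/(smooth_differentiable sf). Qed.

Lemma smooth_derive V W (U : set V) (f : V -> W) v :
  smooth U f -> smooth U ('D_v f).
Proof. by move=> sf k; have [_ /(_ v)] := sf k.+1. Qed.

(** Near [x] the two functions have the same first-order expansion, so the differential of [f]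
    serves for [g]; [diff_unique] then identifies it with ['d g x]. *)
Lemma differentiable_eq_open V W (U : set V) (f g : V -> W) x :
  open U -> U x -> {in U, f =1 g} -> differentiable f x -> differentiable g x.
Proof.
move=> oU Ux fg df.
have nfg : \forall y \near x, g y = f y.
  by apply: filterS (open_nbhs_nbhs (conj oU Ux)) => y Uy; rewrite fg ?inE.
have gfs : \forall h \near (0 : V), g (h + x) = f (h + x).
  move: nfg; rewrite (near_shift 0 x) /=; apply: filterS => h /=. by rewrite subr0.
have fgx : g x = f x by rewrite fg ?inE.
have [cdf fo] := (diff_locallyP _ _).1 df.
have go : g \o shift x = cst (g x) + 'd f x +o_ 0 id.
  apply/eqaddoP => e e0; have /eqaddoP/(_ e e0) := fo.
  apply: filterS2 gfs => h gf; rewrite -![(_ + _ : _ -> _) _]/(_ + _) -![(- _ : _ ->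
    _) _]/(- _) /= gf fgx; apply.
have dg := diff_unique cdf go.
apply/diff_locallyP. rewrite dg. done. Qed.

Lemma derive_eq_open V W (U : set V) (f g : V -> W) x v :
  open U -> U x -> {in U, f =1 g} -> 'D_v f x = 'D_v g x.
Proof.
move=> oU Ux fg; apply: near_eq_derive.
by apply: filterS (open_nbhs_nbhs (conj oU Ux)) => y Uy; rewrite fg ?inE.
Qed.

Lemma smooth_upto_eq k V W (U : set V) (f g : V -> W) :
  open U -> {in U, f =1 g} -> smooth_upto k U f -> smooth_upto k U g.
Proof.
move=> oU; elim: k f g => [|k IHk] f g fg /=.
  by move=> df x Ux; apply: differentiable_eq_open fg (df x Ux).
move=> [df Df]; split=> [x Ux|v].
  exact: differentiable_eq_open fg (df x Ux).
by apply: IHk (Df v) => x; rewrite inE => Ux; apply: derive_eq_open fg.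
Qed.

Lemma smooth_eq V W (U : set V) (f g : V -> W) :
  open U -> {in U, f =1 g} -> smooth U f -> smooth U g.
Proof. by move=> oU fg sf k; apply: smooth_upto_eq fg (sf k). Qed.

Lemma smooth_cst V W (U : set V) (c : W) : smooth U (cst c).
Proof.
move=> k; elim: k c => [|k IHk] c /=; first by [].
split=> // v; have -> : 'D_v (cst c) = cst (0 : W).
  by apply/funext => x; exact: derive_cst.
exact: IHk.
Qed.

Lemma smooth_id V (U : set V) : smooth U (id : V -> V).
Proof.
case=> [|k]; first by move=> y Uy; exact: ex_diff.
split=> [y Uy|v]; first exact: ex_diff.
have -> : 'D_v (id : V -> V) = cst v by apply/funext => y; exact: derive_id.
exact: smooth_cst.
Qed.

Lemma smooth_uptoD k V W (U : set V) (f g : V -> W) : open U ->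
  smooth_upto k U f -> smooth_upto k U g ->
  smooth_upto k U (fun x => f x + g x).
Proof.
move=> oU; elim: k f g => [|k IHk] f g /=.
  by move=> df dg x Ux; apply: differentiableD; [exact: df|exact: dg].
move=> [df Df] [dg Dg]; split=> [x Ux|v].
  by apply: differentiableD; [exact: df|exact: dg].
apply: smooth_upto_eq (IHk _ _ (Df v) (Dg v)) => // x; rewrite inE => Ux.
rewrite -[RHS]/('D_v (f + g) x) deriveD //; apply: diff_derivable.
  exact: df.
exact: dg.
Qed.

Lemma smoothD V W (U : set V) (f g : V -> W) : open U ->
  smooth U f -> smooth U g -> smooth U (fun x => f x + g x).
Proof. by move=> oU sf sg k; apply: smooth_uptoD. Qed.

(** The product rule multiplies a derivative of one factor by the other factor itself, which is
    known at one order more; [smooth_upto_pred] brings both to the order of the induction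
    hypothesis. *)
Lemma smooth_uptoM k V (U : set V) (f g : V -> R) : open U ->
  smooth_upto k U f -> smooth_upto k U g ->
  smooth_upto k U (fun x => f x * g x).
Proof.
move=> oU; elim: k f g => [|k IHk] f g.
  by move=> df dg x Ux; apply: differentiableM; [exact: df|exact: dg].
move=> sf sg; have [df Df] := sf; have [dg Dg] := sg; split=> [x Ux|v].
  by apply: differentiableM; [exact: df|exact: dg].
apply: smooth_upto_eq (smooth_uptoD oU (IHk _ _ (smooth_upto_pred sf) (Dg v))
  (IHk _ _ (smooth_upto_pred sg) (Df v))) => // x; rewrite inE => Ux.
rewrite -[RHS]/('D_v (f * g) x) deriveM //; apply: diff_derivable.
  exact: df.
exact: dg.
Qed.

Lemma smoothM V (U : set V) (f g : V -> R) : open U ->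
  smooth U f -> smooth U g -> smooth U (fun x => f x * g x).
Proof. by move=> oU sf sg k; apply: smooth_uptoM. Qed.

Lemma smoothZ V (U : set V) (c : R) (f : V -> R) : open U ->
  smooth U f -> smooth U (fun x => c * f x).
Proof. by move=> oU; apply: smoothM => //; exact: smooth_cst. Qed.

Lemma smoothN V (U : set V) (f : V -> R) : open U ->
  smooth U f -> smooth U (fun x => - f x).
Proof.
move=> oU sf; apply: smooth_eq (smoothZ (-1) oU sf) => // x _.
by rewrite mulN1r.
Qed.

Lemma smooth_uptoZ k V W (U : set V) (c : R) (f : V -> W) : open U ->
  smooth_upto k U f -> smooth_upto k U (fun x => c *: f x).
Proof.
move=> oU; elim: k f => [|k IHk] f.
  by move=> df x Ux; apply: differentiableZ; exact: df.
move=> [df Df]; split=> [x Ux|v].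
  by apply: differentiableZ; exact: df.
apply: smooth_upto_eq (IHk _ (Df v)) => // x; rewrite inE => Ux.
by rewrite -[RHS]/('D_v (c \*: f) x) deriveZ //; exact/diff_derivable/df.
Qed.

Lemma smooth_upto_sum k V W (U : set V) (I : Type) (r : seq I) (P : pred I)
    (f : I -> V -> W) : open U -> (forall i, smooth_upto k U (f i)) ->
  smooth_upto k U (fun x => \sum_(i <- r | P i) f i x).
Proof.
move=> oU sf; elim: r => [|i r IHr].
  by apply: smooth_upto_eq (@smooth_cst _ _ U 0 k) => // x _; rewrite big_nil.
case Pi: (P i); last first.
  by apply: smooth_upto_eq IHr => // x _; rewrite big_cons Pi.
by apply: smooth_upto_eq (smooth_uptoD oU (sf i) IHr) => // x _; rewrite big_cons Pi.
Qed.

Lemma smooth_sum V W (U : set V) (I : Type) (r : seq I) (P : pred I)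
    (f : I -> V -> W) : open U ->
  (forall i, smooth U (f i)) -> smooth U (fun x => \sum_(i <- r | P i) f i x).
Proof. by move=> oU sf k; apply: smooth_upto_sum => // i; exact: sf. Qed.

Lemma smooth_prod V (U : set V) (I : Type) (r : seq I) (P : pred I)
    (f : I -> V -> R) : open U ->
  (forall i, smooth U (f i)) -> smooth U (fun x => \prod_(i <- r | P i) f i x).
Proof.
move=> oU sf; elim: r => [|i r IHr].
  by apply: smooth_eq (@smooth_cst _ R U 1) => // x _; rewrite big_nil.
case Pi: (P i); last first.
  by apply: smooth_eq IHr => // x _; rewrite big_cons Pi.
by apply: smooth_eq (smoothM oU (sf i) IHr) => // x _; rewrite big_cons Pi.
Qed.

(** The function stays fixed in the induction: the derivative of 1/f is -(1/f)^2 times the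
    derivative of f, so it involves the same inverse at one order less. *)
Lemma smooth_uptoV k V (U : set V) (f : V -> R) : open U ->
  (forall x, U x -> f x != 0) ->
  smooth_upto k U f -> smooth_upto k U (fun x => (f x)^-1).
Proof.
move=> oU f0; elim: k => [|k IHk].
  by move=> df x Ux; apply: differentiableV; [exact: df|exact: f0].
move=> sf; have [df Df] := sf; split=> [x Ux|v].
  by apply: differentiableV; [exact: df|exact: f0].
have sV := IHk (smooth_upto_pred sf).
have sVV := smooth_uptoM oU sV sV.
have s1 := smooth_uptoM oU (@smooth_cst V R U (-1) k) (smooth_uptoM oU sVV (Df v)).
apply: smooth_upto_eq s1 => // x; rewrite inE => Ux.
rewrite deriveV ?f0//; last exact/diff_derivable/df.
by rewrite /cst mulN1r -expr2 exprVn -mulNr.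
Qed.

Lemma smoothV V (U : set V) (f : V -> R) : open U ->
  (forall x, U x -> f x != 0) -> smooth U f -> smooth U (fun x => (f x)^-1).
Proof. by move=> oU f0 sf k; apply: smooth_uptoV. Qed.

End Smoothness.

(** * Matrix-valued functions, entry by entry, and the chain rule *)

Section MatrixSmoothness.
Context {R : realType}.
Implicit Types V W : normedModType R.

Lemma differentiable_mx V m n (M : V -> 'M[R]_(m, n)) x :
  (forall i j, differentiable (fun y => M y i j) x) -> differentiable M x.
Proof.
move=> dM.
have -> : M = \sum_i \sum_j (fun y => M y i j *: delta_mx i j).
  apply/funext => y; rewrite {1}(matrix_sum_delta (M y)).
  rewrite fct_sumE; apply: eq_bigr => i _.
  by rewrite fct_sumE.
apply: differentiable_sum => i; apply: differentiable_sum => j.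
exact: differentiableZl.
Qed.

Lemma differentiable_coef V m n (M : V -> 'M[R]_(m, n)) x i j :
  differentiable M x -> differentiable (fun y => M y i j) x.
Proof.
move=> dM; apply: (@differentiable_comp _ _ _ _ M (fun N : 'M[R]_(m, n) => N i j)) =>
  //.
exact: differentiable_coord.
Qed.

Lemma derive_coef V m n (M : V -> 'M[R]_(m, n)) x v i j :
  derivable M x v -> ('D_v M x) i j = 'D_v (fun y => M y i j) x.
Proof. by move=> dM; rewrite derive_mx // mxE. Qed.

Lemma smooth_coef V m n (U : set V) (M : V -> 'M[R]_(m, n)) i j :
  open U -> smooth U M -> smooth U (fun y => M y i j).
Proof.
move=> oU sM k; elim: k M sM => [|k IHk] M sM.
  by move=> x Ux; apply: differentiable_coef; exact: smooth_differentiable Ux.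
split=> [x Ux|v].
  by apply: differentiable_coef; exact: smooth_differentiable Ux.
apply: smooth_upto_eq (IHk _ (smooth_derive v sM)) => // x; rewrite inE => Ux.
by rewrite derive_coef //; exact: smooth_derivable Ux.
Qed.

Lemma smooth_mx V m n (U : set V) (M : V -> 'M[R]_(m, n)) :
  open U -> (forall i j, smooth U (fun y => M y i j)) -> smooth U M.
Proof.
move=> oU sM k; elim: k M sM => [|k IHk] M sM.
  move=> x Ux; apply: differentiable_mx => i j.
  exact: smooth_differentiable (sM i j) Ux.
have dM x : U x -> differentiable M x.
  move=> Ux; apply: differentiable_mx => i j.
  exact: smooth_differentiable (sM i j) Ux.
split=> // v; apply: IHk => i j.
apply: smooth_eq (smooth_derive v (sM i j)) => // x; rewrite inE => Ux.
by rewrite derive_coef //; exact/diff_derivable/dM.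
Qed.

Lemma smooth_mulmx V m n p (U : set V) (A : V -> 'M[R]_(m, n))
    (B : V -> 'M[R]_(n, p)) : open U -> smooth U A -> smooth U B ->
  smooth U (fun y => A y *m B y).
Proof.
move=> oU sA sB; apply: smooth_mx => // i j.
have := smooth_sum (index_enum 'I_n) xpredT oU
  (fun k => smoothM oU (smooth_coef i k oU sA) (smooth_coef k j oU sB)).
by apply: smooth_eq => // y _; rewrite mxE.
Qed.

Lemma smooth_trmx V m n (U : set V) (A : V -> 'M[R]_(m, n)) :
  open U -> smooth U A -> smooth U (fun y => (A y)^T).
Proof.
move=> oU sA; apply: smooth_mx => // i j.
by apply: smooth_eq (smooth_coef j i oU sA) => // y _; rewrite mxE.
Qed.

Lemma smooth_scale V m n (U : set V) (c : V -> R) (A : V -> 'M[R]_(m, n)) :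
  open U -> smooth U c -> smooth U A -> smooth U (fun y => c y *: A y).
Proof.
move=> oU sc sA; apply: smooth_mx => // i j.
by apply: smooth_eq (smoothM oU sc (smooth_coef i j oU sA)) => // y _; rewrite mxE.
Qed.

Lemma smooth_oppmx V m n (U : set V) (A : V -> 'M[R]_(m, n)) :
  open U -> smooth U A -> smooth U (fun y => - A y).
Proof.
move=> oU sA; apply: smooth_eq (smooth_scale oU (@smooth_cst _ V R U (-1)) sA) => //.
by move=> y _; rewrite scaleN1r.
Qed.

Lemma smooth_det V n (U : set V) (A : V -> 'M[R]_n) :
  open U -> smooth U A -> smooth U (fun y => \det (A y)).
Proof.
move=> oU sA; rewrite /determinant; apply: smooth_sum => // s.
by apply: smoothZ => //; apply: smooth_prod => // i; exact: smooth_coef.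
Qed.

Lemma smooth_invmx V n (U : set V) (A : V -> 'M[R]_n) : open U ->
  (forall y, U y -> A y \in unitmx) -> smooth U A ->
  smooth U (fun y => invmx (A y)).
Proof.
move=> oU uA sA.
have sadj : smooth U (fun y => \adj (A y)).
  apply: smooth_mx => // i j.
  have s1 : smooth U (fun y => cofactor (A y) j i).
    rewrite /cofactor; apply: smoothZ => //; apply: smooth_det => //.
    apply: smooth_mx => // k l.
    by apply: smooth_eq (smooth_coef (lift j k) (lift i l) oU sA) => // y _; rewrite
      !mxE.
  by apply: smooth_eq s1 => // y _; rewrite mxE.
have det0 y : U y -> \det (A y) != 0.
  by move=> Uy; have := uA y Uy; rewrite unitmxE unitfE.
have sdet := smoothV oU det0 (smooth_det oU sA).
apply: smooth_eq (smooth_scale oU sdet sadj) => // y; rewrite inE => Uy.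
by rewrite /invmx uA.
Qed.

Lemma derivable_coef V m n (M : V -> 'M[R]_(m, n)) x v i j :
  derivable M x v -> derivable (fun y => M y i j) x v.
Proof. by move/derivable_mxP; apply. Qed.

Lemma derive_add V W (f g : V -> W) x v : derivable f x v -> derivable g x v ->
  'D_v (fun y => f y + g y) x = 'D_v f x + 'D_v g x.
Proof. exact: deriveD. Qed.

Lemma derivable_mulr V (f g : V -> R) x v : derivable f x v -> derivable g x v ->
  derivable (fun y => f y * g y) x v.
Proof. by move=> df dg; exact (derivableM df dg). Qed.

Lemma derive_mulr V (f g : V -> R) x v : derivable f x v -> derivable g x v ->
  'D_v (fun y => f y * g y) x = 'D_v f x * g x + f x * 'D_v g x.
Proof.
move=> df dg; rewrite -[LHS]/('D_v (f * g) x) (deriveM df dg) addrC.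
by rewrite /GRing.scale /= [g x * _]mulrC.
Qed.

Lemma derive_mulmx V m n p (A : V -> 'M[R]_(m, n)) (B : V -> 'M[R]_(n, p)) x v :
  derivable A x v -> derivable B x v ->
  'D_v (fun y => A y *m B y) x = 'D_v A x *m B x + A x *m 'D_v B x.
Proof.
move=> dA dB.
have dAB i j k : derivable (fun y => A y i k * B y k j) x v.
  exact: derivable_mulr (derivable_coef dA) (derivable_coef dB).
have E i j : (fun y => (A y *m B y) i j) =
    \sum_k (fun y => A y i k * B y k j).
  by apply/funext => y; rewrite mxE fct_sumE.
have dABE i j : derivable (fun y => (A y *m B y) i j) x v.
  by rewrite E; exact: derivable_sum (dAB i j).
apply/matrixP => i j; rewrite (derive_coef _ _ ((derivable_mxP _ _ _).2 dABE)).
rewrite E (derive_sum (dAB i j)) !mxE -big_split /=; apply: eq_bigr => k _.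
rewrite (derive_mulr (derivable_coef dA) (derivable_coef dB)).
by rewrite (derive_coef _ _ dA) (derive_coef _ _ dB).
Qed.

Lemma derive_trmx V m n (A : V -> 'M[R]_(m, n)) x v :
  derivable A x v -> 'D_v (fun y => (A y)^T) x = ('D_v A x)^T.
Proof.
move=> dA.
have E i j : (fun y => (A y)^T i j) = (fun y => A y j i).
  by apply/funext => y; rewrite mxE.
have dAE i j : derivable (fun y => (A y)^T i j) x v.
  by rewrite E; exact: derivable_coef dA.
apply/matrixP => i j; rewrite (derive_coef _ _ ((derivable_mxP _ _ _).2 dAE)).
by rewrite E mxE (derive_coef _ _ dA).
Qed.

Lemma derive_scale V m n (c : V -> R) (A : V -> 'M[R]_(m, n)) x v :
  derivable c x v -> derivable A x v ->
  'D_v (fun y => c y *: A y) x = 'D_v c x *: A x + c x *: 'D_v A x.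
Proof.
move=> dc dA.
have E i j : (fun y => (c y *: A y) i j) = (fun y => c y * A y i j).
  by apply/funext => y; rewrite mxE.
have dE i j : derivable (fun y => (c y *: A y) i j) x v.
  by rewrite E; exact: derivable_mulr dc (derivable_coef dA).
apply/matrixP => i j; rewrite (derive_coef _ _ ((derivable_mxP _ _ _).2 dE)).
by rewrite E (derive_mulr dc (derivable_coef dA)) !mxE (derive_coef _ _ dA).
Qed.

Lemma derive_dirD V W (f : V -> W) x u v : differentiable f x ->
  'D_(u + v) f x = 'D_u f x + 'D_v f x.
Proof. by move=> df; rewrite !deriveE // linearD. Qed.

Lemma derive_dirZ V W (f : V -> W) x (a : R) v : differentiable f x ->
  'D_(a *: v) f x = a *: 'D_v f x.
Proof. by move=> df; rewrite !deriveE // linearZ. Qed.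

Lemma derive_dir_sum V W (f : V -> W) x n (v : 'I_n -> V) : differentiable f x ->
  'D_(\sum_i v i) f x = \sum_i 'D_(v i) f x.
Proof.
by move=> df; rewrite deriveE // linear_sum; apply: eq_bigr => i _; rewrite deriveE.
Qed.

Lemma derive_basis d W (f : 'rV[R]_d -> W) x v : differentiable f x ->
  'D_v f x = \sum_j v 0 j *: 'D_(basisv j) f x.
Proof.
move=> df; rewrite {1}(row_sum_delta v) derive_dir_sum //.
by apply: eq_bigr => j _; rewrite derive_dirZ.
Qed.

Lemma derive_comp V V' W (f : V' -> W) (g : V -> V') x v :
  differentiable g x -> differentiable f (g x) ->
  'D_v (fun y => f (g y)) x = 'D_('D_v g x) f (g x).
Proof.
move=> dg df; rewrite -[fun y => _]/(f \o g) deriveE; last exact: differentiable_comp.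
by rewrite diff_comp //= !deriveE.
Qed.

(** For scalar [h], the derivative of h(g(x)) along v is the sum over j of (D_v g)_j times the j-th
    partial of h at g(x): the induction varies the outer function and keeps [g]. *)
Lemma smooth_comp V d n p (U : set V) (U' : set 'rV[R]_d) (f : 'rV[R]_d -> 'M[R]_(n, p))
    (g : V -> 'rV[R]_d) : open U -> open U' -> (forall x, U x -> U' (g x)) ->
  smooth U' f -> smooth U g -> smooth U (fun x => f (g x)).
Proof.
move=> oU oU' gU sf sg.
suff sc (h : 'rV[R]_d -> R) : smooth U' h -> smooth U (fun x => h (g x)).
  by apply: smooth_mx => // i j; apply: (sc (fun y => f y i j)); exact: smooth_coef.
move=> sh k; elim: k h sh => [|k IHk] h sh.
  move=> x Ux; apply: (@differentiable_comp _ _ _ _ g h).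
    exact: smooth_differentiable Ux.
  exact: smooth_differentiable sh (gU _ Ux).
split=> [x Ux|v].
  apply: (@differentiable_comp _ _ _ _ g h).
    exact: smooth_differentiable Ux.
  exact: smooth_differentiable sh (gU _ Ux).
have s1 j : smooth_upto k U (fun x => ('D_v g x) 0 j * 'D_(basisv j) h (g x)).
  apply: smooth_uptoM oU (smooth_coef 0 j oU (smooth_derive v sg) _) _.
  exact: IHk (smooth_derive _ sh).
have := smooth_upto_sum (index_enum 'I_d) xpredT oU s1.
apply: smooth_upto_eq => // x; rewrite inE => Ux.
have dh := smooth_differentiable sh (gU _ Ux).
by rewrite (derive_comp _ (smooth_differentiable sg Ux) dh) (derive_basis _ dh).
Qed.

(** [smooth_on] knows basis directions only. The induction is over all iterated partials at once,
    since a derivative of [partials f s] along [v] is a combination of the [partials f (j :: s)]. *)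
Lemma smooth_on_smooth d W (U : set 'rV[R]_d) (f : 'rV[R]_d -> W) :
  open U -> smooth_on U f -> smooth U f.
Proof.
move=> oU sf.
suff H k s : smooth_upto k U (partials f s) by move=> k; exact: (H k [::]).
elim: k s => [|k IHk] s; first exact: sf.
split=> [|v]; first exact: sf.
have := smooth_upto_sum (index_enum 'I_d) xpredT oU
  (fun j => smooth_uptoZ (v 0 j) oU (IHk (j :: s))).
apply: smooth_upto_eq => // x; rewrite inE => Ux.
by rewrite -derive_basis //; exact: sf.
Qed.

End MatrixSmoothness.

(** * Symmetry of second derivatives *)

Section Schwarz.
Context {R : realType}.
Implicit Types V : normedModType R.

Lemma derive_line V (g : V -> R) (y w : V) (s : R) :
  differentiable g (y + s *: w) ->
  is_derive s 1 (fun t => g (y + t *: w)) ('D_w g (y + s *: w)).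
Proof.
move=> dg.
have dl : is_diff s (fun t : R => y + t *: w) (fun t => t *: w).
  apply: (is_diff_eq (is_diffD (is_diff_cst y s) (is_diff_scalel s w))).
  by apply/funext => t; rewrite /= add0r.
have dlx : differentiable (fun t : R => y + t *: w) s by exact: ex_diff.
apply: DeriveDef.
  apply: diff_derivable.
  exact: (@differentiable_comp _ _ _ _ (fun t : R => y + t *: w) g).
rewrite (@derive_comp _ _ _ _ g (fun t : R => y + t *: w)) //; congr ('D_ _ g _).
by rewrite deriveE // diff_val scale1r.
Qed.

Lemma MVT_line V (g : V -> R) (y w : V) (h : R) : 0 <= h ->
  (forall s : R, 0 <= s <= h -> differentiable g (y + s *: w)) ->
  exists2 s : R, 0 <= s <= h & g (y + h *: w) - g y = h * 'D_w g (y + s *: w).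
Proof.
move=> h0 dg.
have dgl s : s \in `[0, h]%R ->
    is_derive s 1 (fun t => g (y + t *: w)) ('D_w g (y + s *: w)).
  by rewrite in_itv /= => sh; apply: derive_line; exact: dg.
have dgl' (s : R) : s \in `]0, h[%R ->
    is_derive s 1 (fun t => g (y + t *: w)) ('D_w g (y + s *: w)).
  rewrite in_itv /= => /andP[s0 sh].
  by apply: dgl; rewrite in_itv /= (ltW s0) (ltW sh).
have cg : {within `[0, h], continuous (fun t : R => g (y + t *: w))}.
  apply: derivable_within_continuous => s sI.
  exact (@ex_derive _ _ _ _ _ _ _ (dgl s sI)).
have [s sh E] := MVT_segment h0 dgl' cg.
exists s; first by rewrite in_itv in sh.
by rewrite scale0r addr0 subr0 mulrC in E.
Qed.

(** The mean value theorem is applied twice: along [u] to the first difference f(y + h v) - f(y),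
    then along [v] to ['D_u f]. *)
Lemma mixed_difference V (U : set V) (f : V -> R) (x u v : V) (h : R) :
  open U -> smooth U f -> 0 <= h ->
  (forall s t : R, 0 <= s <= h -> 0 <= t <= h -> U (x + s *: u + t *: v)) ->
  exists s t : R, [/\ 0 <= s <= h, 0 <= t <= h &
    f (x + h *: u + h *: v) - f (x + h *: u) - f (x + h *: v) + f x =
    h * h * 'D_v ('D_u f) (x + s *: u + t *: v)].
Proof.
move=> oU sf h0 sU.
have hh : 0 <= h <= h by rewrite h0 lexx.
have h00 : (0:R) <= 0 <= h by rewrite lexx h0.
have Uv0 s : 0 <= s <= h -> U (x + s *: u).
  by move=> sh; rewrite -[_ + _]addr0 -(scale0r v); exact: sU.
pose g y := f (y + h *: v) - f y.
have dsh y : is_diff y (fun z => z + h *: v) id.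
  apply: (is_diff_eq (is_diffD (is_diff_id y) (is_diff_cst (h *: v) y))).
  by apply/funext => t; rewrite /= addr0.
have dsx y : differentiable (fun z => z + h *: v) y by exact: ex_diff.
have dg y w : U y -> U (y + h *: v) ->
    differentiable g y /\ 'D_w g y = 'D_w f (y + h *: v) - 'D_w f y.
  move=> Uy Uyh.
  have df := smooth_differentiable sf Uy.
  have dfh := smooth_differentiable sf Uyh.
  have dc : differentiable (fun z => f (z + h *: v)) y.
    exact: (@differentiable_comp _ _ _ _ (fun z => z + h *: v) f).
  split; first exact: differentiableB dc df.
  rewrite -[LHS]/('D_w ((fun z => f (z + h *: v)) - f) y).
  rewrite (deriveB (diff_derivable dc) (diff_derivable df)).
  by rewrite (derive_comp _ (dsx y) dfh) [X in 'D_X f _]deriveE // diff_val.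
have [s sh Es] := MVT_line h0 (fun s sh => (dg _ u (Uv0 s sh) (sU s h sh hh)).1).
have [t th Et] := MVT_line h0 (fun t th =>
  smooth_differentiable (smooth_derive u sf) (sU s t sh th)).
exists s, t; split=> //.
rewrite -mulrA -Et -(dg _ u (Uv0 s sh) (sU s h sh hh)).2 -Es /g.
by rewrite addrAC !opprB !addrA -addrA; ring.
Qed.

(** The second difference over a parallelogram is symmetric in [u] and [v], so [mixed_difference]
    read both ways equates the two mixed derivatives at two points close to [x]; continuity brings
    both to [x]. *)
Lemma derive_comm_scalar V (U : set V) (f : V -> R) (x u v : V) :
  open U -> smooth U f -> U x -> 'D_u ('D_v f) x = 'D_v ('D_u f) x.
Proof.
move=> oU sf Ux; apply/eqP; rewrite -subr_eq0 -normr_le0; apply/ler_addgt0Pl => e e0.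
have key (a b c : R) : `|a - c| < e / 2 -> `|b - c| < e / 2 -> `|a - b| <= e + 0.
  move=> ac bc; rewrite addr0 (splitr e) -(subrKA c).
  by apply: le_trans (ler_normD _ _) (lerD (ltW ac) _); rewrite distrC ltW.
have e2 : 0 < e / 2 by rewrite divr_gt0.
have cont w z : {for x, continuous ('D_w ('D_z f))}.
  apply: differentiable_continuous.
  exact: smooth_differentiable (smooth_derive w (smooth_derive z sf)) Ux.
have near w z : \forall y \near x, `|'D_w ('D_z f) x - 'D_w ('D_z f) y| < e / 2.
  exact: ((cvgrPdist_lt _ _).1 (cont w z)).
have : \forall y \near x, [/\ U y, `|'D_u ('D_v f) x - 'D_u ('D_v f) y| < e / 2
    & `|'D_v ('D_u f) x - 'D_v ('D_u f) y| < e / 2].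
  apply: filterS3 (open_nbhs_nbhs (conj oU Ux)) (near u v) (near v u) => y.
  by split.
move=> /nbhs_ballP[d /= d0 H].
(* This makes h (|u| + |v|) < d, so both parallelograms lie in the ball; the 1 keeps the denominator
   positive when u = v = 0. *)
pose h := d / (1 + `|u| + `|v|).
have D0 : 0 < 1 + `|u| + `|v| by rewrite -addrA ltr_wpDr // addr_ge0.
have h0 : 0 < h by rewrite divr_gt0.
have inb (s t : R) p q : `|p| + `|q| = `|u| + `|v| -> 0 <= s <= h -> 0 <= t <= h ->
    ball x d (x + s *: p + t *: q).
  move=> pq /andP[s0 sh] /andP[t0 th]; rewrite -ball_normE /= -addrA opprD addNKr
    normrN.
  apply: le_lt_trans (ler_normD _ _) _; rewrite !normrZ !ger0_norm //.
  apply: (@le_lt_trans _ _ (h * (`|p| + `|q|))).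
    by rewrite mulrDr lerD // ler_wpM2r.
  by rewrite pq /h mulrAC ltr_pdivrMr // ltr_pM2l // -addrA ltr_pwDl.
have inu s t := inb s t u v erefl.
have inv s t := inb s t v u (addrC _ _).
have [s [t [sh th E1]]] := mixed_difference oU sf (ltW h0)
  (fun s t sh th => (let: And3 Uy _ _ := H _ (inu s t sh th) in Uy)).
have [p [q [ph qh E2]]] := mixed_difference oU sf (ltW h0)
  (fun s t sh th => (let: And3 Uy _ _ := H _ (inv s t sh th) in Uy)).
have [_ _ B1] := H _ (inu s t sh th).
have [_ B2 _] := H _ (inv p q ph qh).
have hh0 : h * h != 0 by rewrite mulf_neq0 // gt_eqF.
have E : 'D_v ('D_u f) (x + s *: u + t *: v) = 'D_u ('D_v f) (x + p *: v + q *: u).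
  apply: (mulfI hh0); refine (etrans (esym E1) (etrans _ E2)).
  by rewrite (addrAC x (h *: v)); ring.
by rewrite E in B1; exact: key B2 B1.
Qed.

Lemma derive_comm V m n (U : set V) (f : V -> 'M[R]_(m, n)) (x u v : V) :
  open U -> smooth U f -> U x -> 'D_u ('D_v f) x = 'D_v ('D_u f) x.
Proof.
move=> oU sf Ux; apply/matrixP => i j.
have E w : {in U, (fun y => 'D_w f y i j) =1 'D_w (fun y => f y i j)}.
  by move=> y; rewrite inE => Uy; apply: derive_coef; exact: smooth_derivable Uy.
have sD w := smooth_derive w sf.
have D w z : ('D_w ('D_z f) x) i j = 'D_w ('D_z (fun y => f y i j)) x.
  transitivity ('D_w (fun y => 'D_z f y i j) x).
    exact: (derive_coef _ _ (smooth_derivable (sD z) Ux)).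
  exact: (derive_eq_open _ oU Ux (E z)).
have S := derive_comm_scalar u v oU (smooth_coef i j oU sf) Ux.
exact: etrans (D u v) (etrans S (esym (D v u))).
Qed.

End Schwarz.

(** * Linear algebra *)

Section BilinearForms.
Context {R : realType}.
Implicit Types V : normedModType R.

Lemma bilDl d (A : 'M[R]_d) u v w : bil A (u + v) w = bil A u w + bil A v w.
Proof. by rewrite /bil !mulmxDl mxE. Qed.

Lemma bilDr d (A : 'M[R]_d) u v w : bil A u (v + w) = bil A u v + bil A u w.
Proof. by rewrite /bil linearD mulmxDr mxE. Qed.

Lemma bilZl d (A : 'M[R]_d) a u v : bil A (a *: u) v = a * bil A u v.
Proof. by rewrite /bil -!scalemxAl mxE. Qed.

Lemma bilZr d (A : 'M[R]_d) a u v : bil A u (a *: v) = a * bil A u v.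
Proof. by rewrite /bil linearZ -scalemxAr mxE. Qed.

Lemma bilNl d (A : 'M[R]_d) u v : bil A (- u) v = - bil A u v.
Proof. by rewrite -scaleN1r bilZl mulN1r. Qed.

Lemma bilNr d (A : 'M[R]_d) u v : bil A u (- v) = - bil A u v.
Proof. by rewrite -scaleN1r bilZr mulN1r. Qed.

Lemma bilBl d (A : 'M[R]_d) u v w : bil A (u - v) w = bil A u w - bil A v w.
Proof. by rewrite bilDl bilNl. Qed.

Lemma bilBr d (A : 'M[R]_d) u v w : bil A u (v - w) = bil A u v - bil A u w.
Proof. by rewrite bilDr bilNr. Qed.

Lemma bil0l d (A : 'M[R]_d) v : bil A 0 v = 0.
Proof. by rewrite -(scale0r 0) bilZl mul0r. Qed.

Lemma bil0r d (A : 'M[R]_d) v : bil A v 0 = 0.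
Proof. by rewrite -(scale0r 0) bilZr mul0r. Qed.

Lemma bil_suml d (A : 'M[R]_d) (I : finType) (f : I -> 'rV[R]_d) v :
  bil A (\sum_i f i) v = \sum_i bil A (f i) v.
Proof. by rewrite (big_morph (bil A ^~ v) (fun a b => bilDl A a b v) (bil0l A v)). Qed.

Lemma bil_sumr d (A : 'M[R]_d) (I : finType) (f : I -> 'rV[R]_d) v :
  bil A v (\sum_i f i) = \sum_i bil A v (f i).
Proof. by rewrite (big_morph (bil A v) (bilDr A v) (bil0r A v)). Qed.

Lemma bilC d (A : 'M[R]_d) u v : A^T = A -> bil A u v = bil A v u.
Proof.
move=> sA; rewrite /bil -[in LHS](trmxK (u *m A *m v^T)) mxE.
by rewrite !trmx_mul trmxK sA mulmxA.
Qed.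

Lemma bil_addM d (A B : 'M[R]_d) u v : bil (A + B) u v = bil A u v + bil B u v.
Proof. by rewrite /bil mulmxDr mulmxDl mxE. Qed.

Lemma bil_scaleM d a (A : 'M[R]_d) u v : bil (a *: A) u v = a * bil A u v.
Proof. by rewrite /bil -scalemxAr -scalemxAl mxE. Qed.

Lemma bil_sumM d (I : finType) (A : I -> 'M[R]_d) u v :
  bil (\sum_i A i) u v = \sum_i bil (A i) u v.
Proof.
apply: (big_morph (fun B => bil B u v)); first by move=> B C; rewrite bil_addM.
by rewrite /bil mulmx0 mul0mx mxE.
Qed.

Lemma pairingD d (w : 'cV[R]_d) u v : pairing w (u + v) = pairing w u + pairing w v.
Proof. by rewrite /pairing mulmxDl mxE. Qed.

Lemma pairingZ d (w : 'cV[R]_d) a v : pairing w (a *: v) = a * pairing w v.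
Proof. by rewrite /pairing -scalemxAl mxE. Qed.

Lemma pairingN d (w : 'cV[R]_d) v : pairing w (- v) = - pairing w v.
Proof. by rewrite -scaleN1r pairingZ mulN1r. Qed.

Lemma smooth_bil V d (U : set V) (A : V -> 'M[R]_d) X Y : open U ->
  smooth U A -> smooth U X -> smooth U Y -> smooth U (fun y => bil (A y) (X y) (Y y)).
Proof.
move=> oU sA sX sY.
exact: (smooth_coef 0 0 oU (smooth_mulmx oU (smooth_mulmx oU sX sA) (smooth_trmx oU
  sY))).
Qed.

Lemma derivable_mulmx V m n p (A : V -> 'M[R]_(m, n)) (B : V -> 'M[R]_(n, p)) x v :
  derivable A x v -> derivable B x v -> derivable (fun y => A y *m B y) x v.
Proof.
move=> dA dB; apply/derivable_mxP => i j.
rewrite (_ : (fun y => _) = \sum_k (fun y => A y i k * B y k j)); last first.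
  by apply/funext => y; rewrite mxE fct_sumE.
apply: derivable_sum => k.
exact: derivable_mulr (derivable_coef dA) (derivable_coef dB).
Qed.

Lemma derivable_trmx V m n (A : V -> 'M[R]_(m, n)) x v :
  derivable A x v -> derivable (fun y => (A y)^T) x v.
Proof.
move=> dA; apply/derivable_mxP => i j.
rewrite (_ : (fun y => _) = (fun y => A y j i)); last by apply/funext => y; rewrite mxE.
exact: derivable_coef dA.
Qed.

Lemma derive_bil V d (A : V -> 'M[R]_d) X Y x v :
  derivable A x v -> derivable X x v -> derivable Y x v ->
  'D_v (fun y => bil (A y) (X y) (Y y)) x = bil ('D_v A x) (X x) (Y x) +
    bil (A x) ('D_v X x) (Y x) + bil (A x) (X x) ('D_v Y x).
Proof.
move=> dA dX dY.
have dXA := derivable_mulmx dX dA.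
have dYT := derivable_trmx dY.
rewrite /bil -(derive_coef 0 0 (derivable_mulmx dXA dYT)).
rewrite (derive_mulmx dXA dYT) (derive_mulmx dX dA) (derive_trmx dY).
by rewrite mulmxDl !mxE [X in X + _]addrC.
Qed.

Lemma derive_pairing V d (w : V -> 'cV[R]_d) X x v :
  derivable w x v -> derivable X x v ->
  'D_v (fun y => pairing (w y) (X y)) x =
    pairing ('D_v w x) (X x) + pairing (w x) ('D_v X x).
Proof.
move=> dw dX; rewrite /pairing -(derive_coef 0 0 (derivable_mulmx dX dw)).
by rewrite (derive_mulmx dX dw) mxE addrC.
Qed.

Lemma derive_sym_mx V n (U : set V) (A : V -> 'M[R]_n) x v : open U -> U x ->
  derivable A x v -> (forall y, U y -> (A y)^T = A y) -> ('D_v A x)^T = 'D_v A x.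
Proof.
move=> oU Ux dA sA; rewrite -(derive_trmx dA).
by apply: (derive_eq_open v oU Ux) => y; rewrite inE => Uy; exact: sA.
Qed.

Lemma posdef_unitmx d (A : 'M[R]_d) :
  (forall u, u != 0 -> 0 < bil A u u) -> A \in unitmx.
Proof.
move=> pA; rewrite -row_free_unit -kermx_eq0.
apply/eqP/row_matrixP => i; rewrite row0.
apply/eqP; apply: contraT => /pA.
have /sub_kermxP rA : (row i (kermx A) <= kermx A)%MS by exact: row_sub.
by rewrite /bil rA mul0mx mxE ltxx.
Qed.

(** [christoffel] tests the Koszul expression against basis vectors only. By linearity it can be
    tested against any [w]; with [C k] the k-th partial of the metric, the last term becomes its
    derivative along [w]. *)
Lemma koszul_row d (A B : 'M[R]_d) (C : 'I_d -> 'M[R]_d) (u v w : 'rV[R]_d) :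
  (\row_k (2^-1 * (bil A v (basisv k) + bil B u (basisv k) - bil (C k) u v))
    *m w^T) 0 0 =
  2^-1 * (bil A v w + bil B u w - bil (\sum_k w 0 k *: C k) u v).
Proof.
have E (D : 'M[R]_d) a : bil D a w = \sum_k w 0 k * bil D a (basisv k).
  by rewrite {1}(row_sum_delta w) bil_sumr; apply: eq_bigr => k _; rewrite bilZr.
rewrite !E bil_sumM -big_split -sumrB mulr_sumr mxE.
by apply: eq_bigr => k _; rewrite !mxE bil_scaleM /=; ring.
Qed.

End BilinearForms.

(** * Pointwise identities of an almost contact metric structure *)

Section ContactAlgebra.
Context {R : realType} {d : nat} (g phi : 'M[R]_d) (xi : 'rV[R]_d) (eta : 'cV[R]_d).
Hypothesis phi_sqr : forall v, v *m phi *m phi = - v + pairing eta v *: xi.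
Hypothesis eta_xi : pairing eta xi = 1.
Hypothesis g_phi : forall u v, bil g (u *m phi) (v *m phi) =
  bil g u v - pairing eta u * pairing eta v.

(** As phi^2 xi = 0, the formula for phi^2 at phi xi gives phi xi = a xi with a = eta(phi xi).
    Applying phi again yields a phi xi = 0, and either factor being zero suffices. *)
Lemma xi_phi : xi *m phi = 0.
Proof.
have xi_phi2 : xi *m phi *m phi = 0 by rewrite phi_sqr eta_xi scale1r addNr.
have E : xi *m phi = pairing eta (xi *m phi) *: xi.
  apply/eqP; rewrite -subr_eq0 -oppr_eq0 opprB addrC -phi_sqr.
  by rewrite xi_phi2 mul0mx.
have := congr1 (mulmx^~ phi) E; rewrite /= xi_phi2 -scalemxAl => /esym/eqP.
rewrite scaler_eq0 => /orP[/eqP c0|/eqP//].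
by rewrite E c0 scale0r.
Qed.

Lemma bil_xi u : bil g u xi = pairing eta u.
Proof.
apply/eqP; rewrite -subr_eq0 -{1}[pairing eta u]mulr1 -eta_xi -g_phi.
by rewrite xi_phi bil0r.
Qed.

(** Computing phi^3 u as phi^2 of phi u and as phi of phi^2 u leaves eta(phi u) xi = 0, and xi is
    nonzero because eta(xi) = 1. *)
Lemma eta_phi u : pairing eta (u *m phi) = 0.
Proof.
have /eqP := phi_sqr (u *m phi).
rewrite (phi_sqr u) mulmxDl mulNmx -scalemxAl xi_phi scaler0 addr0.
rewrite -subr_eq0 opprD addrA subrr add0r oppr_eq0 scaler_eq0 => /orP[/eqP//|/eqP xi0].
by move: eta_xi; rewrite xi0 /pairing mul0mx mxE => /esym/eqP; rewrite oner_eq0.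
Qed.

Lemma phi_skew u v : bil g (u *m phi) v = - bil g u (v *m phi).
Proof.
have := g_phi u (v *m phi); rewrite eta_phi mulr0 subr0 phi_sqr => <-.
by rewrite bilDr bilZr bil_xi eta_phi mulr0 addr0 bilNr opprK.
Qed.

End ContactAlgebra.

(** * Kaehler curvature tensors of constant holomorphic sectional curvature *)

Section KaehlerAlgebra.
Context {R : realType} {V : zmodType} (J : V -> V) (D : V -> Prop).
Context (t : V -> V -> V -> V -> R) (g : V -> V -> R) (k : R).
Hypothesis tD : forall X X' Y Z W, t (X + X') Y Z W = t X Y Z W + t X' Y Z W.
Hypothesis t12 : forall X Y Z W, t Y X Z W = - t X Y Z W.
Hypothesis t34 : forall X Y Z W, t X Y W Z = - t X Y Z W.
Hypothesis tB : forall X Y Z W, t X Y Z W + t Y Z X W + t Z X Y W = 0.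
Hypothesis JD : forall X Y, J (X + Y) = J X + J Y.
(** [J] will be phi, which squares to minus the identity only on the contact distribution: this is
    the role of [D]. *)
Hypothesis JJ : forall X, D X -> J (J X) = - X.
Hypothesis tJ : forall X Y Z W, D W -> t X Y (J Z) (J W) = t X Y Z W.
Hypothesis DD : forall X Y, D X -> D Y -> D (X + Y).
Hypothesis DN : forall X, D X -> D (- X).
Hypothesis DJ : forall X, D X -> D (J X).
Hypothesis gD : forall X Y Z, g (X + Y) Z = g X Z + g Y Z.
Hypothesis gC : forall X Y, g X Y = g Y X.
Hypothesis gJ : forall X Y, D X -> D Y -> g (J X) (J Y) = g X Y.
Hypothesis hol : forall X, D X -> t X (J X) (J X) X = k * g X X ^+ 2.

(** The usual octahedron argument: a combination of the four Bianchi identities obtained by cycling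
    all four arguments. *)
Let t_pair X Y Z W : t X Y Z W = t Z W X Y.
Proof.
have := tB X Y Z W; have := tB Y Z W X; have := tB Z W X Y; have := tB W X Y Z.
rewrite (t34 X Y Z W) (t34 Y Z X W) (t34 Z W X Y) (t34 W X Z Y).
rewrite (t12 X Z Y W) (t34 X Z Y W) (t12 W Y X Z) (t34 W Y X Z).
by move=> *; lra.
Qed.

Let tN X Y Z W : t (- X) Y Z W = - t X Y Z W.
Proof.
have t0 : t 0 Y Z W = 0 by apply: (addrI (t 0 Y Z W)); rewrite -tD !addr0.
by apply: (addrI (t X Y Z W)); rewrite -tD !subrr.
Qed.

Let gN X Y : g (- X) Y = - g X Y.
Proof.
have g0 : g 0 Y = 0 by apply: (addrI (g 0 Y)); rewrite -gD !addr0.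
by apply: (addrI (g X Y)); rewrite -gD !subrr.
Qed.

Let tD2 X Y Y' Z W : t X (Y + Y') Z W = t X Y Z W + t X Y' Z W.
Proof. by rewrite t12 tD opprD -!t12. Qed.

Let tD3 X Y Z Z' W : t X Y (Z + Z') W = t X Y Z W + t X Y Z' W.
Proof. by rewrite t_pair tD !(t_pair _ W). Qed.

Let tD4 X Y Z W W' : t X Y Z (W + W') = t X Y Z W + t X Y Z W'.
Proof. by rewrite t_pair tD2 !(t_pair Z). Qed.

Let JN X : J (- X) = - J X.
Proof.
have J0 : J 0 = 0 by apply: (addrI (J 0)); rewrite -JD !addr0.
by apply: (addrI (J X)); rewrite -JD !subrr.
Qed.

Let tJ12 X Y Z W : D Y -> t (J X) (J Y) Z W = t X Y Z W.
Proof. by move=> DY; rewrite t_pair tJ // t_pair. Qed.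

(* The part of bidegree (2, 2) of [hol] at [X + Y], extracted by adding the
   identity at [X - Y]. *)
Lemma hol_polarised X Y : D X -> D Y ->
  t X (J X) (J Y) Y + t Y (J Y) (J X) X + t X (J Y) (J X) Y + t Y (J X) (J Y) X
  + t X (J Y) (J Y) X + t Y (J X) (J X) Y
  = k * (2 * g X X * g Y Y + 4 * g X Y ^+ 2).
Proof.
move=> DX DY.
have H1 := hol (DD DX DY); have H2 := hol (DD DX (DN DY)).
have HX := hol DX; have HY := hol DY.
rewrite !JD !(tD, tD2, tD3, tD4) !gD !(gC _ (X + Y)) !gD (gC Y X) in H1.
rewrite !JD !JN !(tD, tD2, tD3, tD4) !gD !(gC _ (X - Y)) !gD !gN !(gC _ (- Y)) !gN
  (gC Y X) in H2.
have t2 A B E F : t A (- B) E F = - t A B E F by rewrite t12 tN (t12 B) opprK.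
have t3 A B E F : t A B (- E) F = - t A B E F by rewrite t_pair tN t_pair.
have t4 A B E F : t A B E (- F) = - t A B E F by rewrite t_pair t2 t_pair.
rewrite !(tN, t2, t3, t4) in H2.
by lra.
Qed.

(** Bianchi and invariance under [J] reduce the six terms of [hol_polarised] to two unknowns: 2
    times the value on (X, Y) plus 6 times the value on (X, J Y). *)
Lemma mixed_sectional X Y : D X -> D Y ->
  t X Y Y X + 3 * t X (J Y) (J Y) X = k * (g X X * g Y Y + 2 * g X Y ^+ 2).
Proof.
move=> DX DY; have H := hol_polarised DX DY.
have e12 A B E F : D A -> t B (J A) E F = t A (J B) E F.
  by move=> DA; rewrite -(tJ12 B E F (DJ DA)) (JJ DA) t12 tN opprK.
have e34 A B E F : D A -> t E F (J A) B = t E F (J B) A.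
  by move=> DA; rewrite t34 t_pair (e12 _ _ _ _ DA) t_pair -t34.
have e A B : D A -> D B -> t A (J A) (J B) B = t A B B A + t A (J B) (J B) A.
  move=> DA DB; have := tB A (J A) (J B) B.
  rewrite (tJ12 _ _ _ DB) (t34 A B B A) (t12 A (J B)) (e34 A B _ _ DA).
  by move=> *; lra.
move: H; rewrite (e X Y) // (e Y X) // (e34 X Y X) // (e12 X Y (J Y) X) //.
rewrite (e12 X Y (J X) Y) // (e34 X Y X) // (t12 X Y X Y) (t34 X Y Y X).
by move=> *; lra.
Qed.

(** Replacing [Y] by [J Y] exchanges the two unknowns of [mixed_sectional]; three times the new
    equation minus the old one isolates the value on (X, Y). *)
Lemma kaehler_sectional X Y : D X -> D Y ->
  4 * t X Y Y X = k * (g X X * g Y Y + 3 * g X (J Y) ^+ 2 - g X Y ^+ 2).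
Proof.
move=> DX DY; have H1 := mixed_sectional DX DY.
have H2 := mixed_sectional DX (DJ DY); move: H2; rewrite (JJ DY).
have -> : t X (- Y) (- Y) X = t X Y Y X by rewrite t_pair tN t_pair t12 tN !opprK -t12.
rewrite (gJ DY DY).
by move=> *; lra.
Qed.

End KaehlerAlgebra.

(** * The Levi-Civita connection in a chart *)

Section LeviCivita.
Context {R : realType} {d : nat} (U : set 'rV[R]_d) (G : 'rV[R]_d -> 'M[R]_d).
Hypotheses (oU : open U) (sG : smooth U G).
Hypothesis symG : forall x, U x -> (G x)^T = G x.
Hypothesis posG : forall x u, U x -> u != 0 -> 0 < bil (G x) u u.

Lemma bil_ge0 x u : U x -> 0 <= bil (G x) u u.
Proof.
move=> Ux; have [->|u0] := eqVneq u 0; first by rewrite bil0l.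
exact/ltW/posG.
Qed.

Lemma bil_eq0 x u : U x -> bil (G x) u u = 0 -> u = 0.
Proof.
by move=> Ux u0; apply/eqP; apply: contraT => /(posG Ux); rewrite u0 ltxx.
Qed.

Lemma bil_inj x u v : U x -> (forall w, bil (G x) u w = bil (G x) v w) -> u = v.
Proof.
move=> Ux uv; apply/eqP; rewrite -subr_eq0; apply/eqP/(bil_eq0 Ux).
by rewrite bilBl uv subrr.
Qed.

Lemma metric_unitmx x : U x -> G x \in unitmx.
Proof. by move=> Ux; apply: posdef_unitmx => u; exact: posG. Qed.

Lemma metric_differentiable x : U x -> differentiable G x.
Proof. exact: smooth_differentiable sG. Qed.

Lemma bil_christoffel x u v w : U x -> bil (G x) (christoffel G x u v) w =
  2^-1 * (bil ('D_u G x) v w + bil ('D_v G x) u w - bil ('D_w G x) u v).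
Proof.
move=> Ux; rewrite {1}/bil /christoffel mulmxKV ?metric_unitmx //.
by rewrite (derive_basis w (metric_differentiable Ux)); exact: koszul_row.
Qed.

Lemma sym_derive_metric x v : U x -> ('D_v G x)^T = 'D_v G x.
Proof.
move=> Ux; apply: (derive_sym_mx oU Ux _ symG).
exact: diff_derivable (metric_differentiable Ux).
Qed.

Lemma christoffelC x u v : U x -> christoffel G x u v = christoffel G x v u.
Proof.
move=> Ux; apply: (bil_inj Ux) => w.
rewrite (bil_christoffel u v w Ux) (bil_christoffel v u w Ux).
move: (sym_derive_metric w Ux).
generalize ('D_u G x) ('D_v G x) ('D_w G x) => A B C sC.
by rewrite (bilC v u sC); ring.
Qed.

Lemma christoffelDr x u v w : U x ->
  christoffel G x u (v + w) = christoffel G x u v + christoffel G x u w.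
Proof.
move=> Ux; apply: (bil_inj Ux) => z; rewrite bilDl.
rewrite (bil_christoffel u (v + w) z Ux) (bil_christoffel u v z Ux).
rewrite (bil_christoffel u w z Ux) (derive_dirD _ _ (metric_differentiable Ux)).
generalize ('D_u G x) ('D_v G x) ('D_w G x) ('D_z G x) => A B C D.
by rewrite bil_addM bilDl bilDr; ring.
Qed.

Lemma christoffelZr x a u v : U x ->
  christoffel G x u (a *: v) = a *: christoffel G x u v.
Proof.
move=> Ux; apply: (bil_inj Ux) => z; rewrite bilZl.
rewrite (bil_christoffel u (a *: v) z Ux) (bil_christoffel u v z Ux).
rewrite (derive_dirZ _ _ (metric_differentiable Ux)).
generalize ('D_u G x) ('D_v G x) ('D_z G x) => A B C.
by rewrite bil_scaleM bilZl bilZr; ring.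
Qed.

Lemma christoffelDl x u v w : U x ->
  christoffel G x (u + v) w = christoffel G x u w + christoffel G x v w.
Proof. by move=> Ux; rewrite !(christoffelC _ w Ux) christoffelDr. Qed.

Lemma christoffelZl x a u v : U x ->
  christoffel G x (a *: u) v = a *: christoffel G x u v.
Proof. by move=> Ux; rewrite !(christoffelC _ v Ux) christoffelZr. Qed.

(** The connection form evaluated on [v], as a matrix acting on the right: covariant differentiation
    becomes ['D_v] plus a matrix product, and curvature a matrix expression. *)
Definition christoffel_mx v x : 'M[R]_d :=
  \matrix_i christoffel G x v (basisv i).

Lemma christoffelE x v w : U x -> christoffel G x v w = w *m christoffel_mx v x.
Proof.
move=> Ux; rewrite {1}(row_sum_delta w) mulmx_sum_row.
rewrite (big_morph (christoffel G x v) (id1 := 0) (op1 := +%R)); first last.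
- by rewrite -[X in christoffel _ _ _ X](scale0r 0) christoffelZr // scale0r.
- by move=> a b; exact: christoffelDr.
by apply: eq_bigr => i _; rewrite christoffelZr // rowK.
Qed.

Lemma christoffel_mxD u v x : U x ->
  christoffel_mx (u + v) x = christoffel_mx u x + christoffel_mx v x.
Proof.
by move=> Ux; apply/row_matrixP => i; rewrite linearD /= !rowK christoffelDl.
Qed.

Lemma christoffel_mxZ a u x : U x ->
  christoffel_mx (a *: u) x = a *: christoffel_mx u x.
Proof.
by move=> Ux; apply/row_matrixP => i; rewrite linearZ /= !rowK christoffelZl.
Qed.

Lemma christoffel_mx_sum v x : U x ->
  christoffel_mx v x = \sum_i v 0 i *: christoffel_mx (basisv i) x.
Proof.
move=> Ux; rewrite {1}(row_sum_delta v).
rewrite (big_morph (christoffel_mx ^~ x) (id1 := 0) (op1 := +%R)); first last.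
- by rewrite -[X in christoffel_mx X](scale0r 0) christoffel_mxZ // scale0r.
- by move=> a b; exact: christoffel_mxD.
by apply: eq_bigr => i _; rewrite christoffel_mxZ.
Qed.

Lemma smooth_christoffel_mx v : smooth U (christoffel_mx v).
Proof.
have sb a b c : smooth U (fun y => bil ('D_a G y) b c).
  by apply: smooth_bil => //; [exact: smooth_derive|exact: smooth_cst|exact:
    smooth_cst].
have sr i : smooth U (fun y => christoffel G y v (basisv i)).
  apply: smooth_mulmx => //; last first.
    by apply: smooth_invmx => //; exact: metric_unitmx.
  apply: smooth_mx => // k l.
  have s1 := smoothD oU (smoothD oU (sb v (basisv i) (basisv l))
    (sb (basisv i) v (basisv l))) (smoothN oU (sb (basisv l) v (basisv i))).
  by apply: smooth_eq (smoothZ 2^-1 oU s1) => // y _; rewrite mxE.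
apply: smooth_mx => // i j.
by apply: smooth_eq (smooth_coef 0 j oU (sr i)) => // y _; rewrite [RHS]mxE.
Qed.

(** * The pull-back connection along a map *)

Section AlongMap.
Context {m : nat} (O : set 'rV[R]_m) (F : 'rV[R]_m -> 'rV[R]_d).
Hypotheses (oO : open O) (sF : smooth O F) (FO : forall x, O x -> U (F x)).

Lemma smooth_christoffel (X Y : 'rV[R]_m -> 'rV[R]_d) : smooth O X -> smooth O Y ->
  smooth O (fun y => christoffel G (F y) (X y) (Y y)).
Proof.
move=> sX sY.
have s1 i : smooth O (fun y => X y 0 i *: christoffel_mx (basisv i) (F y)).
  apply: smooth_scale => //; first exact: smooth_coef.
  exact: smooth_comp (smooth_christoffel_mx _) sF.
have := smooth_mulmx oO sY (smooth_sum (index_enum 'I_d) xpredT oO s1).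
apply: smooth_eq => // y; rewrite inE => Oy.
by rewrite christoffelE ?christoffel_mx_sum //; exact: FO.
Qed.

Lemma smooth_nabla_along u (X : 'rV[R]_m -> 'rV[R]_d) : smooth O X ->
  smooth O (nabla_along G F u X).
Proof.
move=> sX; apply: smoothD => //; first exact: smooth_derive.
by apply: smooth_christoffel => //; exact: smooth_derive.
Qed.

Lemma derive_metric x u : O x ->
  'D_u (fun y => G (F y)) x = 'D_('D_u F x) G (F x).
Proof.
move=> Ox; apply: derive_comp; first exact: smooth_differentiable Ox.
exact: metric_differentiable (FO Ox).
Qed.

(** Metric compatibility: in the sum of the two Koszul expressions everything cancels but the
    derivative of the metric along dF(u), which is what the chain rule produces on the left. *)
Lemma derive_bil_along u X Y x : O x -> smooth O X -> smooth O Y ->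
  'D_u (fun y => bil (G (F y)) (X y) (Y y)) x =
    bil (G (F x)) (nabla_along G F u X x) (Y x) +
    bil (G (F x)) (X x) (nabla_along G F u Y x).
Proof.
move=> Ox sX sY; have UFx := FO Ox.
have sGF : smooth O (fun y => G (F y)) by exact: smooth_comp sG sF.
rewrite (derive_bil (smooth_derivable sGF Ox) (smooth_derivable sX Ox)
  (smooth_derivable sY Ox)) derive_metric //.
have sD w := sym_derive_metric w UFx.
rewrite /nabla_along bilDl bilDr (bilC (X x) (christoffel _ _ _ _) (symG UFx)).
rewrite (bil_christoffel _ (X x) (Y x) UFx) (bil_christoffel _ (Y x) (X x) UFx).
move: (sD ('D_u F x)) (sD (X x)) (sD (Y x)).
generalize ('D_('D_u F x) G (F x)) ('D_(X x) G (F x)) ('D_(Y x) G (F x)) => A B C.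
generalize (X x) (Y x) ('D_u F x) ('D_u X x) ('D_u Y x) (G (F x)) => X0 Y0 F0 DX DY G0.
move=> sA sB sC; rewrite (bilC Y0 X0 sA) (bilC F0 Y0 sB) (bilC F0 X0 sC).
by field.
Qed.

Lemma nabla_alongC u v x : O x ->
  nabla_along G F u ('D_v F) x = nabla_along G F v ('D_u F) x.
Proof.
move=> Ox; rewrite /nabla_along (derive_comm u v oO sF Ox).
by rewrite (christoffelC _ _ (FO Ox)).
Qed.

End AlongMap.

(** * Covariant derivatives of vector fields and the curvature tensor *)

Lemma nablaE u Z x : U x -> nabla G u Z x = 'D_u Z x + Z x *m christoffel_mx u x.
Proof. by move=> Ux; rewrite /nabla (christoffelE _ _ Ux). Qed.

Lemma smooth_nabla u Z : smooth U Z -> smooth U (nabla G u Z).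
Proof.
move=> sZ; have s1 := smooth_mulmx oU sZ (smooth_christoffel_mx u).
apply: smooth_eq (smoothD oU (smooth_derive u sZ) s1) => // y.
by rewrite inE => Uy; rewrite nablaE.
Qed.

Lemma nabla_eq u Z Z' x : U x -> {in U, Z =1 Z'} -> nabla G u Z x = nabla G u Z' x.
Proof.
move=> Ux ZZ'; rewrite /nabla (derive_eq_open u oU Ux ZZ').
by rewrite (ZZ' x) ?inE.
Qed.

Lemma nablaD u X Y x : U x -> smooth U X -> smooth U Y ->
  nabla G u (fun y => X y + Y y) x = nabla G u X x + nabla G u Y x.
Proof.
move=> Ux sX sY; rewrite /nabla.
rewrite (derive_add (smooth_derivable sX Ux) (smooth_derivable sY Ux)).
by rewrite (christoffelDr _ _ _ Ux) addrACA.
Qed.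

Lemma nablaZ u (c : 'rV[R]_d -> R) X x : U x -> smooth U c -> smooth U X ->
  nabla G u (fun y => c y *: X y) x = 'D_u c x *: X x + c x *: nabla G u X x.
Proof.
move=> Ux sc sX; rewrite /nabla.
rewrite (derive_scale (smooth_derivable sc Ux) (smooth_derivable sX Ux)).
by rewrite (christoffelZr _ _ _ Ux) scalerDr addrA.
Qed.

Lemma nabla2E u v Z x : U x -> smooth U Z ->
  nabla G u (nabla G v Z) x =
    'D_u ('D_v Z) x + ('D_u Z x *m christoffel_mx v x + Z x *m 'D_u (christoffel_mx
      v) x)
    + ('D_v Z x + Z x *m christoffel_mx v x) *m christoffel_mx u x.
Proof.
move=> Ux sZ; rewrite (nablaE _ _ Ux) (nablaE _ _ Ux).
have sM := smooth_christoffel_mx v.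
have E : {in U, nabla G v Z =1 fun y => 'D_v Z y + Z y *m christoffel_mx v y}.
  by move=> y; rewrite inE => Uy; rewrite nablaE.
rewrite (derive_eq_open u oU Ux E); congr (_ + _).
rewrite (derive_add (smooth_derivable (smooth_derive v sZ) Ux)
  (smooth_derivable (smooth_mulmx oU sZ sM) Ux)); congr (_ + _).
exact: derive_mulmx (smooth_derivable sZ Ux) (smooth_derivable sM Ux).
Qed.

Lemma curvatureE x u v w : U x -> curvature G x u v w =
  w *m ('D_u (christoffel_mx v) x + christoffel_mx v x *m christoffel_mx u x
    - 'D_v (christoffel_mx u) x - christoffel_mx u x *m christoffel_mx v x).
Proof.
move=> Ux; have sw : smooth U (cst w) by exact: smooth_cst.
have N a b : nabla G a (nabla G b (cst w)) x =
    w *m ('D_a (christoffel_mx b) x + christoffel_mx b x *m christoffel_mx a x).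
  rewrite (nabla2E a b Ux sw).
  have H1 (z : 'rV[R]_d) y : 'D_z (cst w) y = 0 by exact: derive_cst.
  have H2 : 'D_a ('D_b (cst w)) x = 0.
    by rewrite (_ : 'D_b (cst w) = cst 0) ?derive_cst //; apply/funext => y.
  generalize ('D_a (christoffel_mx b) x) (christoffel_mx a x) (christoffel_mx b x).
  move=> A B C; rewrite H2 (H1 a x) (H1 b x).
  by rewrite /cst !mul0mx !add0r mulmxDr mulmxA.
rewrite /curvature !N -mulmxBr; congr (_ *m _).
by rewrite opprD addrA.
Qed.

(** Tensoriality: [curvature] is defined through constant fields, and the derivatives of a variable
    [Z] cancel by the symmetry of second derivatives. It is applied below to the field phi w. *)
Lemma nabla_comm u v Z x : U x -> smooth U Z ->
  nabla G u (nabla G v Z) x - nabla G v (nabla G u Z) x = curvature G x u v (Z x).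
Proof.
move=> Ux sZ; rewrite (curvatureE _ _ _ Ux) (nabla2E u v Ux sZ) (nabla2E v u Ux sZ).
rewrite (derive_comm u v oU sZ Ux).
move: ('D_v ('D_u Z) x) ('D_u Z x) ('D_v Z x) (Z x) => A B C D.
move: (christoffel_mx u x) (christoffel_mx v x) => Mu Mv.
move: ('D_u (christoffel_mx v) x) ('D_v (christoffel_mx u) x) => E F.
rewrite !mulmxBr !mulmxDr !mulmxDl !mulmxA !opprD.
apply/matrixP => i j; rewrite !mxE; ring.
Qed.

Lemma curvature_skew x u v w : curvature G x v u w = - curvature G x u v w.
Proof. by rewrite /curvature opprB. Qed.

(** For constant fields, absence of torsion reads nabla_b c = nabla_c b; the six second derivatives
    then cancel in pairs. *)
Lemma curvature_bianchi x u v w : U x ->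
  curvature G x u v w + curvature G x v w u + curvature G x w u v = 0.
Proof.
move=> Ux.
have E a b c : nabla G a (nabla G b (cst c)) x = nabla G a (nabla G c (cst b)) x.
  apply: (nabla_eq _ Ux) => y; rewrite inE => Uy.
  by rewrite /nabla !derive_cst !add0r; exact: christoffelC.
rewrite /curvature (E v w u) (E w u v) (E u v w).
move: (nabla _ _ _ _) (nabla _ _ _ _) (nabla _ _ _ _) => A B C.
by apply/matrixP => i j; rewrite !mxE; ring.
Qed.

Lemma curvatureZr x u v a w : U x ->
  curvature G x u v (a *: w) = a *: curvature G x u v w.
Proof. by move=> Ux; rewrite !(curvatureE _ _ _ Ux) scalemxAl. Qed.

Lemma curvatureDl x u v w z : U x ->
  curvature G x (u + v) w z = curvature G x u w z + curvature G x v w z.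
Proof.
move=> Ux; rewrite !(curvatureE _ _ _ Ux) -mulmxDr; congr (_ *m _).
have sM a := smooth_christoffel_mx a.
have E : {in U, christoffel_mx (u + v) =1 fun y => christoffel_mx u y +
  christoffel_mx v y}.
  by move=> y; rewrite inE => Uy; rewrite christoffel_mxD.
rewrite (derive_dirD _ _ (smooth_differentiable (sM w) Ux)) (derive_eq_open _ oU Ux E).
rewrite (derive_add (smooth_derivable (sM u) Ux) (smooth_derivable (sM v) Ux)).
rewrite (christoffel_mxD _ _ Ux) mulmxDr mulmxDl.
move: ('D_u _ x) ('D_v _ x) ('D_w _ x) ('D_w _ x) => A B C D.
move: (_ *m _) (_ *m _) (_ *m _) (_ *m _) => A' B' C' D'.
by apply/matrixP => i j; rewrite !mxE; ring.
Qed.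

Lemma curvatureZl x a u v w : U x ->
  curvature G x (a *: u) v w = a *: curvature G x u v w.
Proof.
move=> Ux; rewrite !(curvatureE _ _ _ Ux) scalemxAr; congr (_ *m _).
have sM b := smooth_christoffel_mx b.
have E : {in U, christoffel_mx (a *: u) =1 fun y => a *: christoffel_mx u y}.
  by move=> y; rewrite inE => Uy; rewrite christoffel_mxZ.
rewrite (derive_dirZ _ _ (smooth_differentiable (sM v) Ux)) (derive_eq_open _ oU Ux E).
rewrite (deriveZ _ (smooth_derivable (sM u) Ux)) (christoffel_mxZ _ _ Ux).
by rewrite -scalemxAr -scalemxAl !scalerBr scalerDr.
Qed.

Lemma nabla_along_id u X : nabla_along G id u X = nabla G u X.
Proof. by apply/funext => x; rewrite /nabla_along /nabla derive_id. Qed.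

Lemma derive_bil_nabla u X Y x : U x -> smooth U X -> smooth U Y ->
  'D_u (fun y => bil (G y) (X y) (Y y)) x =
    bil (G x) (nabla G u X x) (Y x) + bil (G x) (X x) (nabla G u Y x).
Proof.
move=> Ux sX sY; rewrite -!nabla_along_id.
have sid := @smooth_id R _ U.
exact: (derive_bil_along oU sid (fun y Uy => Uy) u Ux sX sY).
Qed.

(* Both sides come from commuting the derivatives of [g(w, z)] along [u], [v]. *)
Lemma curvature_metric x u v w z : U x ->
  bil (G x) (curvature G x u v w) z = - bil (G x) w (curvature G x u v z).
Proof.
move=> Ux; have sc a : smooth U (cst a : 'rV[R]_d -> 'rV[R]_d) by exact: smooth_cst.
pose q y := bil (G y) w z.
have sq : smooth U q := smooth_bil oU sG (sc w) (sc z).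
have sn a b : smooth U (nabla G a (cst b)) by exact: smooth_nabla.
have D1 a y : U y -> 'D_a q y =
    bil (G y) (nabla G a (cst w) y) z + bil (G y) w (nabla G a (cst z) y).
  by move=> Uy; exact: (derive_bil_nabla a Uy (sc w) (sc z)).
have D2 a b : 'D_a ('D_b q) x =
   bil (G x) (nabla G a (nabla G b (cst w)) x) z +
   bil (G x) (nabla G b (cst w) x) (nabla G a (cst z) x) +
   (bil (G x) (nabla G a (cst w) x) (nabla G b (cst z) x) +
   bil (G x) w (nabla G a (nabla G b (cst z)) x)).
  have E : {in U, 'D_b q =1 fun y => bil (G y) (nabla G b (cst w) y) z +
      bil (G y) w (nabla G b (cst z) y)}.
    by move=> y; rewrite inE => Uy; exact: D1.
  rewrite (derive_eq_open a oU Ux E).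
  rewrite (derive_add (smooth_derivable (smooth_bil oU sG (sn b w) (sc z)) Ux)
    (smooth_derivable (smooth_bil oU sG (sc w) (sn b z)) Ux)).
  rewrite (derive_bil_nabla a Ux (sn b w) (sc z)).
  by rewrite (derive_bil_nabla a Ux (sc w) (sn b z)).
have := derive_comm_scalar u v oU sq Ux; rewrite !D2 /curvature bilBl bilBr.
move: (nabla G u (nabla G v (cst w)) x) (nabla G v (nabla G u (cst w)) x).
move: (nabla G u (nabla G v (cst z)) x) (nabla G v (nabla G u (cst z)) x).
move: (nabla G u (cst w) x) (nabla G v (cst w) x) (nabla G u (cst z) x) (nabla G v
  (cst z) x).
move: (G x) => G0 A B C D E F I J K; lra.
Qed.

(** * Sasakian structures and the curvature of their space forms *)

Section Sasakian.
Context (phi : 'rV[R]_d -> 'M[R]_d) (xi : 'rV[R]_d -> 'rV[R]_d).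
Context (eta : 'rV[R]_d -> 'cV[R]_d).
Hypotheses (sphi : smooth U phi) (sxi : smooth U xi).
Hypothesis phi_sqr : forall x v, U x ->
  v *m phi x *m phi x = - v + pairing (eta x) v *: xi x.
Hypothesis eta_xi : forall x, U x -> pairing (eta x) (xi x) = 1.
Hypothesis g_phi : forall x u v, U x -> bil (G x) (u *m phi x) (v *m phi x) =
  bil (G x) u v - pairing (eta x) u * pairing (eta x) v.
Hypothesis sasaki : forall x u v, U x ->
  nabla_endo G phi x u v = bil (G x) u v *: xi x - pairing (eta x) v *: u.

Lemma metric_xi x u : U x -> bil (G x) u (xi x) = pairing (eta x) u.
Proof.
move=> Ux; apply: (bil_xi (phi := phi x)) => [v||v w].
- exact: phi_sqr.
- exact: eta_xi.
- exact: g_phi.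
Qed.

(** The Sasakian condition is given on constant fields; the Leibniz rule extends it to variable
    ones, as needed for xi and for second derivatives. *)
Lemma nabla_phi u Z x : U x -> smooth U Z ->
  nabla G u (fun y => Z y *m phi y) x =
  bil (G x) u (Z x) *: xi x - pairing (eta x) (Z x) *: u + nabla G u Z x *m phi x.
Proof.
move=> Ux sZ; rewrite -(sasaki u (Z x) Ux) /nabla_endo.
have sc : smooth U (cst (Z x) : 'rV[R]_d -> 'rV[R]_d) by exact: smooth_cst.
have N Y : smooth U Y -> nabla G u (fun y => Y y *m phi y) x =
    'D_u Y x *m phi x + Y x *m 'D_u phi x + Y x *m phi x *m christoffel_mx u x.
  move=> sY; rewrite (nablaE _ _ Ux).
  by rewrite (derive_mulmx (smooth_derivable sY Ux) (smooth_derivable sphi Ux)).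
rewrite (N Z sZ) (N _ sc) (nablaE _ (cst (Z x)) Ux) (nablaE _ Z Ux) /cst.
move: ('D_u phi x) (phi x) (christoffel_mx u x) ('D_u Z x) (Z x) => A B C E F.
rewrite derive_cst !mulmxDl !mul0mx !add0r.
by move: (E *m B) (F *m A) (F *m B *m C) (F *m C *m B) => a b c e;
  apply/matrixP => i j; rewrite !mxE; ring.
Qed.

(* Differentiate [phi xi = 0] and apply [phi] once more. *)
Lemma nabla_xi u x : U x -> nabla G u xi x = - (u *m phi x).
Proof.
move=> Ux; have := nabla_phi u Ux sxi.
have -> : nabla G u (fun y => xi y *m phi y) x = 0.
  rewrite (nabla_eq (Z' := cst 0) u Ux); last first.
    move=> y; rewrite inE => Uy.
    by apply: (xi_phi (fun v => phi_sqr v Uy) (eta_xi Uy)).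
  by rewrite (nablaE _ _ Ux) derive_cst add0r mul0mx.
rewrite (eta_xi Ux) scale1r (metric_xi _ Ux) => E.
have E1 : nabla G u xi x *m phi x = u - pairing (eta x) u *: xi x.
  by apply: (addrI (pairing (eta x) u *: xi x - u)); rewrite -E addrA subrK subrr.
have H : pairing (eta x) (nabla G u xi x) = 0.
  have := derive_bil_nabla u Ux sxi sxi.
  have E2 : {in U, (fun y => bil (G y) (xi y) (xi y)) =1 cst 1}.
    by move=> y; rewrite inE => Uy; rewrite (metric_xi _ Uy) eta_xi.
  rewrite (derive_eq_open u oU Ux E2) derive_cst.
  rewrite [bil _ (xi x) _](bilC _ _ (symG Ux)) (metric_xi _ Ux).
  by move: (pairing _ _) => a; lra.
have := phi_sqr (nabla G u xi x) Ux.
rewrite H scale0r addr0 E1 mulmxBl -scalemxAl.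
rewrite (xi_phi (fun v => phi_sqr v Ux) (eta_xi Ux)) scaler0 subr0 => ->.
by rewrite opprK.
Qed.

(** The commutator of second derivatives of the field phi w is R(u, v) phi w. Expanding it with the
    Sasakian condition gives phi R(u, v) w plus the terms left by differentiating xi and eta(w). *)
Lemma curvature_phi x u v w : U x -> curvature G x u v (w *m phi x) =
  curvature G x u v w *m phi x
  - bil (G x) v w *: (u *m phi x) + bil (G x) u w *: (v *m phi x)
  + bil (G x) w (u *m phi x) *: v - bil (G x) w (v *m phi x) *: u.
Proof.
move=> Ux; have sc a : smooth U (cst a : 'rV[R]_d -> 'rV[R]_d) by exact: smooth_cst.
have sn a b : smooth U (nabla G a (cst b)) by exact: smooth_nabla.
pose Z y := w *m phi y.
have sZ : smooth U Z by exact: smooth_mulmx (sc w) sphi.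
pose c1 a y := bil (G y) a w.
(* This is -eta(w), written with the metric so that metric compatibility and [nabla_xi]
   differentiate it. *)
pose c2 y := - bil (G y) w (xi y).
have sc1 a : smooth U (c1 a) := smooth_bil oU sG (sc a) (sc w).
have sb : smooth U (fun y => bil (G y) w (xi y)) := smooth_bil oU sG (sc w) sxi.
have sc2 : smooth U c2 := smoothN oU sb.
have N1 a : {in U, nabla G a Z =1
    fun y => c1 a y *: xi y + (c2 y *: cst a y + nabla G a (cst w) y *m phi y)}.
  move=> y; rewrite inE => Uy; rewrite /Z (nabla_phi a Uy (sc w)) -addrA; congr (_ +
    (_ + _)).
  by rewrite /c2 (metric_xi _ Uy) scaleNr.
have Dc1 a b : 'D_a (c1 b) x =
    bil (G x) (nabla G a (cst b) x) w + bil (G x) b (nabla G a (cst w) x).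
  exact: derive_bil_nabla Ux (sc b) (sc w).
have Dc2 a : 'D_a c2 x =
    - bil (G x) (nabla G a (cst w) x) (xi x) + bil (G x) w (a *m phi x).
  rewrite /c2 (deriveN (smooth_derivable sb Ux)).
  rewrite (derive_bil_nabla a Ux (sc w) sxi) (nabla_xi _ Ux) bilNr.
  by rewrite opprD opprK.
have s1 a : smooth U (fun y => c1 a y *: xi y) := smooth_scale oU (sc1 a) sxi.
have s2 a : smooth U (fun y => c2 y *: cst a y) := smooth_scale oU sc2 (sc a).
have s3 a : smooth U (fun y => nabla G a (cst w) y *m phi y) :=
  smooth_mulmx oU (sn a w) sphi.
have N2 a b : nabla G a (nabla G b Z) x =
   ((bil (G x) (nabla G a (cst b) x) w + bil (G x) b (nabla G a (cst w) x)) *: xi x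
     - c1 b x *: (a *m phi x)) +
   (((- bil (G x) (nabla G a (cst w) x) (xi x) + bil (G x) w (a *m phi x)) *: b + c2
     x *: nabla G a (cst b) x) +
   (bil (G x) a (nabla G b (cst w) x) *: xi x
    - bil (G x) (nabla G b (cst w) x) (xi x) *: a
    + nabla G a (nabla G b (cst w)) x *m phi x)).
  rewrite (nabla_eq a Ux (N1 b)) (nablaD a Ux (s1 b) (smoothD oU (s2 b) (s3 b))).
  rewrite (nablaD a Ux (s2 b) (s3 b)) (nablaZ a Ux (sc1 b) sxi).
  rewrite (nablaZ a Ux sc2 (sc b)) (nabla_phi a Ux (sn b w)) (nabla_xi _ Ux).
  by rewrite -Dc1 -Dc2 scalerN (metric_xi (nabla G b (cst w) x) Ux).
apply: etrans (esym (nabla_comm u v Ux sZ)) _; rewrite (N2 u v) (N2 v u).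
have -> : nabla G v (cst u) x = nabla G u (cst v) x.
  rewrite /nabla !derive_cst; congr (_ + _); exact: christoffelC.
rewrite /curvature mulmxBl.
move: (nabla G u (nabla G v (cst w)) x) (nabla G v (nabla G u (cst w)) x) => A B.
move: (nabla G u (cst w) x) (nabla G v (cst w) x) (nabla G u (cst v) x) => C D E.
rewrite /c1 (bilC _ C (symG Ux)) (bilC _ D (symG Ux)).
rewrite [bil _ C v](bilC _ v (symG Ux)) [bil _ D u](bilC _ u (symG Ux)).
move: (c2 x) (xi x) (A *m phi x) (B *m phi x) => c X A' B'.
move: (bil (G x)) (u *m phi x) (v *m phi x) => b Pu Pv.
by apply/matrixP => i j; rewrite !mxE; ring.
Qed.

Lemma curvatureZm x a u v w : U x ->
  curvature G x u (a *: v) w = a *: curvature G x u v w.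
Proof.
move=> Ux; rewrite (curvature_skew x (a *: v) u w) (curvature_skew x v u w).
by rewrite (curvatureZl _ _ _ _ Ux) scalerN.
Qed.

(* [c = 1] is the curvature of the unit sphere: subtracting it makes the
   curvature commute with [phi] on the contact distribution. *)
Definition kaehler_part x u v w z : R :=
  bil (G x) (curvature G x u v w) z -
  (bil (G x) v w * bil (G x) u z - bil (G x) u w * bil (G x) v z).

(** The correction terms of [curvature_phi] do not depend on the curvature, so the sphere term
    subtracted here absorbs them. Horizontality of [z] removes the eta-terms of g(phi A, phi z). *)
Lemma kaehler_part_phi x u v w z : U x -> pairing (eta x) z = 0 ->
  kaehler_part x u v (w *m phi x) (z *m phi x) = kaehler_part x u v w z.
Proof.
move=> Ux z0; rewrite /kaehler_part (curvature_phi _ _ _ Ux).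
have sk a b := phi_skew (fun v => phi_sqr v Ux) (eta_xi Ux) (fun u v => g_phi u v Ux)
  a b.
move: (curvature G x u v w) => A.
rewrite !(bilDl, bilNl, bilZl) !(g_phi _ _ Ux) z0 !mulr0 !subr0.
rewrite (bilC w (u *m phi x) (symG Ux)) (bilC w (v *m phi x) (symG Ux)) !sk.
move: (bil (G x)) => b; ring.
Qed.

Section SpaceForm.
Context (c : R).
Hypothesis phi_sectional : forall x u, U x ->
  bil (G x) u u = 1 -> bil (G x) u (xi x) = 0 -> sectional G x u (u *m phi x) = c.

(** Both sides are homogeneous of degree 4, so a nonzero [u] is scaled by [s] to a unit vector,
    where the hypothesis applies; the sphere accounts for the -1. *)
Lemma kaehler_part_hol x u : U x -> pairing (eta x) u = 0 ->
  kaehler_part x u (u *m phi x) (u *m phi x) u = (c - 1) * bil (G x) u u ^+ 2.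
Proof.
move=> Ux u0; have [->|un0] := eqVneq u 0.
  by rewrite /kaehler_part !mul0mx !bil0l !bil0r; ring.
have sk a b := phi_skew (fun v => phi_sqr v Ux) (eta_xi Ux) (fun u v => g_phi u v Ux)
  a b.
have guu : bil (G x) (u *m phi x) (u *m phi x) = bil (G x) u u.
  by rewrite (g_phi _ _ Ux) u0 mulr0 subr0.
have gu0 : bil (G x) u (u *m phi x) = 0.
  have := sk u u; rewrite (bilC (u *m phi x) u (symG Ux)).
  by move: (bil _ _ _) => a; lra.
pose q := bil (G x) u u; have q0 : 0 < q by exact: posG.
pose s := (Num.sqrt q)^-1.
have ss : s * s * q = 1.
  by rewrite /s -invfM -expr2 sqr_sqrtr ?ltW // mulVf // gt_eqF.
have s0 : s != 0 by rewrite invr_eq0 gt_eqF // sqrtr_gt0.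
have H := @phi_sectional x (s *: u) Ux.
rewrite !bilZl !bilZr (metric_xi _ Ux) u0 mulr0 mulrA ss in H.
have {}H := H erefl erefl; move: H; rewrite /sectional -scalemxAl.
rewrite !(bilZl, bilZr) (curvatureZr _ _ _ _ Ux) (curvatureZm _ _ _ _ Ux).
rewrite (curvatureZl _ _ _ _ Ux) !bilZl gu0 guu -/q !mulrA ss !mulr0 expr0n /= subr0
  mul1r ss divr1.
rewrite /kaehler_part guu gu0 (bilC (u *m phi x) u (symG Ux)) gu0 -/q.
move: (bil _ _ _) => a E.
have -> : a = c * q * q.
  have : (s * s * q) * (s * s * q) * a = c * q * q by rewrite -E; ring.
  by rewrite ss !mul1r.
by ring.
Qed.

(** [kaehler_sectional] at X = u, Y = phi v: since phi^2 v = -v, the term g(X, J Y)^2 becomes g(u,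
    v)^2, while g(X, Y) = 0. Adding back the sphere term turns the coefficient c - 1 of |u|^2 |v|^2
    into c + 3. *)
Lemma bil_curvature_lagrangian x u v : U x ->
  pairing (eta x) u = 0 -> pairing (eta x) v = 0 -> bil (G x) u (v *m phi x) = 0 ->
  4 * bil (G x) (curvature G x u (v *m phi x) (v *m phi x)) u =
  (c + 3) * bil (G x) u u * bil (G x) v v + 3 * (c - 1) * bil (G x) u v ^+ 2.
Proof.
move=> Ux u0 v0 uv0.
have sk a b := phi_skew (fun v => phi_sqr v Ux) (eta_xi Ux) (fun u v => g_phi u v Ux)
  a b.
have eD a b : pairing (eta x) a = 0 -> pairing (eta x) b = 0 ->
    pairing (eta x) (a + b) = 0 by move=> a0 b0; rewrite pairingD a0 b0 addr0.
have eN a : pairing (eta x) a = 0 -> pairing (eta x) (- a) = 0.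
  by move=> a0; rewrite pairingN a0 oppr0.
have eJ a : pairing (eta x) (a *m phi x) = 0.
  by rewrite (eta_phi (fun v => phi_sqr v Ux) (eta_xi Ux)).
have jj a : pairing (eta x) a = 0 -> a *m phi x *m phi x = - a.
  by move=> a0; rewrite (phi_sqr _ Ux) a0 scale0r addr0.
have K : 4 * kaehler_part x u (v *m phi x) (v *m phi x) u =
    (c - 1) * (bil (G x) u u * bil (G x) (v *m phi x) (v *m phi x)
      + 3 * bil (G x) u (v *m phi x *m phi x) ^+ 2 - bil (G x) u (v *m phi x) ^+ 2).
  apply: (kaehler_sectional (J := mulmx^~ (phi x))
    (D := fun w => pairing (eta x) w = 0) (t := kaehler_part x)) => //=.
  - move=> a a' b e f; rewrite /kaehler_part (curvatureDl _ _ _ _ Ux).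
    by move: (curvature _ _ _ _ _) (curvature _ _ _ _ _) => A B; rewrite !bilDl; ring.
  - move=> a b e f; rewrite /kaehler_part (curvature_skew x a b e).
    by move: (curvature _ _ _ _ _) => A; rewrite bilNl; ring.
  - move=> a b e f; rewrite /kaehler_part.
    move: (curvature_metric a b f e Ux).
    move: (curvature G x a b f) (curvature G x a b e) => A B.
    rewrite (bilC f B (symG Ux)); move: (bil (G x)) => g E; lra.
  - move=> a b e f; rewrite /kaehler_part.
    have := congr1 (bil (G x) ^~ f) (curvature_bianchi a b e Ux).
    move: (curvature _ _ _ _ _) (curvature _ _ _ _ _) (curvature _ _ _ _ _) => A B C.
    rewrite /= !bilDl bil0l (bilC b a (symG Ux)) (bilC e a (symG Ux)) (bilC e b (symG
      Ux)).
    by move: (bil (G x)) => g E; lra.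
  - by move=> a b; exact: mulmxDl.
  - by move=> a b e f f0; exact: kaehler_part_phi.
  - by move=> a b e; exact: bilDl.
  - by move=> a b; exact: bilC (symG Ux).
  - by move=> a b a0 b0; rewrite (g_phi _ _ Ux) a0 mul0r subr0.
  - by move=> a a0; exact: kaehler_part_hol.
move: K; rewrite /kaehler_part (jj _ v0) (g_phi _ _ Ux) v0 mulr0 subr0 uv0 bilNr.
rewrite (bilC (v *m phi x) u (symG Ux)) uv0.
by move: (curvature _ _ _ _ _) => A; move: (bil (G x)) => g E; lra.
Qed.

End SpaceForm.
End Sasakian.

End LeviCivita.

(** * Orthonormal frames at a point and traces *)

Section OrthonormalFrames.
Context {R : realType}.

(** One step of the elimination: the induction hypothesis is applied to the Schur complement of the
    top left entry [a]. *)
Lemma cholesky_step n (h : 'M[R]_(1 + n)) :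
  (forall k : 'M[R]_n, k^T = k -> (forall u, u != 0 -> 0 < bil k u u) ->
     exists B : 'M[R]_n, k = B *m B^T) ->
  h^T = h -> (forall u, u != 0 -> 0 < bil h u u) ->
  exists B : 'M[R]_(1 + n), h = B *m B^T.
Proof.
move=> IH; rewrite -[h]submxK.
move: (ulsubmx h) (ursubmx h) (dlsubmx h) (drsubmx h) => a r r' K {h}.
rewrite tr_block_mx => /eq_block_mx[_ r'E _ symK].
have {r'E r'} -> : r' = r^T by rewrite -r'E trmxK.
rewrite [a]mx11_scalar; move: (a 0 0) => {}a posh.
have bilE (s : R) (u : 'rV[R]_n) :
    bil (block_mx a%:M r r^T K) (row_mx s%:M u) (row_mx s%:M u) =
    s * s * a + 2 * s * (u *m r^T) 0 0 + bil K u u.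
  have ru : (r *m u^T) 0 0 = (u *m r^T) 0 0.
    by rewrite -[r *m u^T]trmxK trmx_mul trmxK [LHS]mxE.
  rewrite /bil mul_row_block tr_row_mx mul_row_col !mulmxDl tr_scalar_mx.
  rewrite !mul_scalar_mx !mul_mx_scalar -scalemxAl.
  by move: ru; rewrite !mxE => ru; rewrite ru /= mulr1n; ring.
have a0 : 0 < a.
  have := posh (row_mx 1%:M 0); rewrite bilE mul0mx mxE bil0l !mul1r mulr0 !addr0;
    apply.
  by rewrite row_mx_eq0 oner_eq0.
have [||B KB] := IH (K - a^-1 *: (r^T *m r)).
- by rewrite linearB linearZ /= trmx_mul trmxK symK.
(* The first coordinate is the one minimising the form for fixed [u]; the minimum is the Schur
   complement at [u]. *)
- move=> u u0; have := posh (row_mx (- (u *m r^T) 0 0 / a)%:M u).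
  rewrite bilE row_mx_eq0 (negbTE u0) andbF => /(_ isT).
  rewrite bil_addM -scaleNr bil_scaleM.
  have -> : bil (r^T *m r) u u = (u *m r^T) 0 0 * (u *m r^T) 0 0.
    rewrite /bil mulmxA -mulmxA -[r *m u^T]trmxK trmx_mul trmxK.
    by rewrite mxE big_ord1 [_^T 0 0]mxE.
  move: ((u *m r^T) 0 0) (bil K u u) => p q.
  suff -> : - p / a * (- p / a) * a + 2 * (- p / a) * p + q = q + - a^-1 * (p * p) by
    [].
  by field; rewrite gt_eqF.
pose s := Num.sqrt a.
have s0 : s != 0 by rewrite gt_eqF // sqrtr_gt0.
have ss : s * s = a by rewrite -expr2 sqr_sqrtr // ltW.
exists (block_mx s%:M 0 (s^-1 *: r^T) B).
rewrite tr_block_mx mulmx_block tr_scalar_mx linearZ /= trmxK trmx0.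
rewrite !mulmx0 !mul0mx !addr0 -scalar_mxM ss mul_scalar_mx scalerA mulfV // scale1r.
rewrite mul_mx_scalar scalerA mulfV // scale1r -KB -scalemxAl -scalemxAr scalerA.
by rewrite -invfM ss addrC subrK.
Qed.

Lemma cholesky n (h : 'M[R]_n) : h^T = h ->
  (forall u, u != 0 -> 0 < bil h u u) -> exists B : 'M[R]_n, h = B *m B^T.
Proof.
elim: n h => [|n IHn] h symh posh; last exact: cholesky_step.
by exists 0; apply/matrixP => -[].
Qed.

(** For h = B B^T the rows of A = B^-1 are orthonormal; the second identity is what turns [mtrace],
    weighted by [invmx h], into a sum over these rows. *)
Lemma orthonormal_frame n (h : 'M[R]_n) : h^T = h ->
  (forall u, u != 0 -> 0 < bil h u u) ->
  exists A : 'M[R]_n, A *m h *m A^T = 1%:M /\ A^T *m A = invmx h.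
Proof.
move=> symh posh; have uh := posdef_unitmx posh.
have [B hB] := cholesky symh posh.
have uB : B \in unitmx by move: uh; rewrite hB unitmx_mul => /andP[].
have uBT : B^T \in unitmx by rewrite unitmx_tr.
exists (invmx B); rewrite trmx_inv hB; split.
  by rewrite mulmxA mulVmx // mul1mx mulmxV.
have uh' : B *m B^T \in unitmx by rewrite -hB.
by rewrite -[LHS](mulmxK uh') mulmxA mulmxKV // mulVmx // mul1mx.
Qed.

Lemma frame_unit n (h A : 'M[R]_n) i :
  A *m h *m A^T = 1%:M -> bil h (row i A) (row i A) = 1.
Proof.
move=> AhA; have -> : bil h (row i A) (row i A) = (A *m h *m A^T) i i.
  by rewrite /bil -row_mul !mxE; apply: eq_bigr => k _; rewrite !mxE.
by rewrite AhA mxE eqxx.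
Qed.

Lemma frame_parseval n (h A : 'M[R]_n) z : h \in unitmx -> h^T = h ->
  A^T *m A = invmx h -> \sum_i bil h (row i A) z ^+ 2 = bil h z z.
Proof.
move=> uh symh AA; pose y := A *m h *m z^T.
have yE i : bil h (row i A) z = y i 0.
  by rewrite /bil -row_mul [RHS]mxE mxE; apply: eq_bigr => k _; rewrite [in LHS]mxE.
have -> : bil h z z = (y^T *m y) 0 0.
  rewrite /y !trmx_mul trmxK symh !mulmxA -(mulmxA (z *m h)) AA.
  by rewrite (mulmxK uh).
by rewrite [RHS]mxE; apply: eq_bigr => i _; rewrite yE [y^T _ _]mxE expr2.
Qed.

Lemma mtrace_frame n (h A : 'M[R]_n) (T : 'rV[R]_n -> 'rV[R]_n -> R) :
  A^T *m A = invmx h ->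
  (forall u v w, T (u + v) w = T u w + T v w) ->
  (forall a u v, T (a *: u) v = a * T u v) ->
  (forall u v w, T u (v + w) = T u v + T u w) ->
  (forall a u v, T u (a *: v) = a * T u v) ->
  mtrace h T = \sum_k T (row k A) (row k A).
Proof.
move=> AA TDl TZl TDr TZr.
have T0l v : T 0 v = 0 by rewrite -(scale0r 0) TZl mul0r.
have T0r v : T v 0 = 0 by rewrite -(scale0r 0) TZr mul0r.
have E k : T (row k A) (row k A) =
    \sum_i \sum_j A k i * A k j * T (basisv i) (basisv j).
  rewrite {1}(row_sum_delta (row k A)) (big_morph (T ^~ _) (fun u v => TDl u v _)
    (T0l _)).
  apply: eq_bigr => i _; rewrite TZl [X in T _ X](row_sum_delta (row k A)).
  rewrite (big_morph (T _) (TDr _) (T0r _)) mulr_sumr; apply: eq_bigr => j _.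
  by rewrite TZr !mxE mulrA.
rewrite (eq_bigr _ (fun k _ => E k)) exchange_big /mtrace; apply: eq_bigr => i _.
rewrite exchange_big; apply: eq_bigr => j _ /=.
rewrite -mulr_suml -AA mxE /GRing.scale /=; congr (_ * _).
by apply: eq_bigr => k _; rewrite mxE.
Qed.

(** The shape of the integrand in [mtrace_energy]: [L] stands for w -> R(w, tau) tau, [f] for dF and
    [N] for nabla tau. *)
Lemma mtrace_frame_forms n d (h A : 'M[R]_n) (g : 'M[R]_d)
    (L : 'rV[R]_d -> 'rV[R]_d) (f N : 'rV[R]_n -> 'rV[R]_d) :
  A^T *m A = invmx h ->
  (forall a b, L (a + b) = L a + L b) -> (forall c a, L (c *: a) = c *: L a) ->
  (forall u v, f (u + v) = f u + f v) -> (forall c u, f (c *: u) = c *: f u) ->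
  (forall u v, N (u + v) = N u + N v) -> (forall c u, N (c *: u) = c *: N u) ->
  mtrace h (fun u v => bil g (L (f u)) (f v) - bil g (N u) (N v) : R^o) =
  \sum_k (bil g (L (f (row k A))) (f (row k A)) - bil g (N (row k A)) (N (row k A))).
Proof.
move=> AA LD LZ fD fZ ND NZ.
apply: (mtrace_frame (T := fun u v => bil g (L (f u)) (f v) - bil g (N u) (N v)) AA).
- by move=> u v w; rewrite fD LD ND !bilDl; ring.
- by move=> a u v; rewrite fZ LZ NZ !bilZl; ring.
- by move=> u v w; rewrite fD ND !bilDr; ring.
- by move=> a u v; rewrite fZ NZ !bilZr; ring.
Qed.

(** Raising an index: contracting the covector h(a, .) with the inverse of [h] returns the
    coordinates of [a]. *)
Lemma mtrace_dual n (W : lmodType R) (h : 'M[R]_n) (a : 'rV[R]_n) (f : 'I_n -> W)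
    (T : 'rV[R]_n -> 'rV[R]_n -> W) : h \in unitmx -> h^T = h ->
  (forall i j, T (basisv i) (basisv j) = bil h a (basisv i) *: f j) ->
  mtrace h T = \sum_j a 0 j *: f j.
Proof.
move=> uh symh TE; rewrite /mtrace exchange_big; apply: eq_bigr => j _.
under eq_bigr => i _ do rewrite TE scalerA.
rewrite -scaler_suml; congr (_ *: _).
rewrite -[in RHS](mulmxK uh a) mxE; apply: eq_bigr => i _.
rewrite mulrC; congr (_ * _).
rewrite /bil /basisv trmx_delta -colE mxE; congr (_ _ _).
Qed.

End OrthonormalFrames.

(** * Isometric immersions in charts *)

Section Immersion.
Context {R : realType} {m d : nat}.
Context (U : set 'rV[R]_d) (G : 'rV[R]_d -> 'M[R]_d).
Hypotheses (oU : open U) (sG : smooth U G).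
Hypothesis symG : forall x, U x -> (G x)^T = G x.
Hypothesis posG : forall x u, U x -> u != 0 -> 0 < bil (G x) u u.
Context (O : set 'rV[R]_m) (h : 'rV[R]_m -> 'M[R]_m).
Hypotheses (oO : open O) (sh : smooth O h).
Hypothesis symh : forall x, O x -> (h x)^T = h x.
Hypothesis posh : forall x u, O x -> u != 0 -> 0 < bil (h x) u u.
Context (F : 'rV[R]_m -> 'rV[R]_d).
Hypotheses (sF : smooth O F) (FO : forall x, O x -> U (F x)).
Hypothesis isometric : forall x u v, O x ->
  bil (h x) u v = bil (G (F x)) ('D_u F x) ('D_v F x).

Lemma derive_inner u X Y x : O x -> smooth O X -> smooth O Y ->
  'D_u (fun y => bil (G (F y)) (X y) (Y y)) x =
    bil (G (F x)) (nabla_along G F u X x) (Y x) +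
    bil (G (F x)) (X x) (nabla_along G F u Y x).
Proof. exact: (derive_bil_along oU sG symG posG oO sF FO). Qed.

Lemma smooth_nabla_map u X : smooth O X -> smooth O (nabla_along G F u X).
Proof. exact: (smooth_nabla_along oU sG symG posG oO sF FO). Qed.

Lemma nabla_along_linear (X : 'rV[R]_m -> 'rV[R]_d) x : O x -> smooth O X ->
  (forall u v, nabla_along G F (u + v) X x =
     nabla_along G F u X x + nabla_along G F v X x) /\
  (forall a u, nabla_along G F (a *: u) X x = a *: nabla_along G F u X x).
Proof.
move=> Ox sX; have dF := smooth_differentiable sF Ox.
have dX := smooth_differentiable sX Ox.
split=> [u v|a u]; rewrite /nabla_along.
  rewrite (derive_dirD _ _ dF) (derive_dirD _ _ dX).
  by rewrite (christoffelDl oU sG symG posG _ _ _ (FO Ox)) addrACA.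
rewrite (derive_dirZ _ _ dF) (derive_dirZ _ _ dX).
by rewrite (christoffelZl oU sG symG posG _ _ _ (FO Ox)) scalerDr.
Qed.

Lemma nabla_cst u v x : nabla h u (cst v) x = christoffel h x u v.
Proof. by rewrite /nabla derive_cst add0r. Qed.

(** The tangential part of the Gauss formula. Isometry expresses each derivative of [h] by two
    values of the left-hand side [A]; as [A] is symmetric in its first two arguments, the Koszul
    combination of the six values collapses to [A u v w]. *)
Lemma bil_nabla_dF u v w x : O x ->
  bil (G (F x)) (nabla_along G F u ('D_v F) x) ('D_w F x) =
  bil (h x) (christoffel h x u v) w.
Proof.
move=> Ox; rewrite (bil_christoffel sh posh _ _ _ Ox).
pose A a b c := bil (G (F x)) (nabla_along G F a ('D_b F) x) ('D_c F x).
have AC a b c : A a b c = A b a c.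
  by rewrite /A (nabla_alongC oU sG symG posG oO sF FO _ _ Ox).
have E a b c : bil ('D_a h x) b c = A a b c + A a c b.
  have sb z : smooth O (cst z : 'rV[R]_m -> 'rV[R]_m) by exact: smooth_cst.
  have E1 : 'D_a (fun y => bil (h y) b c) x = bil ('D_a h x) b c.
    rewrite (derive_bil (smooth_derivable sh Ox) (smooth_derivable (sb b) Ox)
      (smooth_derivable (sb c) Ox)) !derive_cst.
    by rewrite bil0l bil0r !addr0.
  rewrite -E1; have E2 : {in O, (fun y => bil (h y) b c) =1
      fun y => bil (G (F y)) ('D_b F y) ('D_c F y)}.
    by move=> y; rewrite inE => Oy; exact: isometric.
  rewrite (derive_eq_open a oO Ox E2).
  rewrite (derive_inner a Ox (smooth_derive b sF) (smooth_derive c sF)).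
  by rewrite /A (bilC ('D_b F x) _ (symG (FO Ox))).
rewrite !E -/(A u v w) (AC v u w) (AC w u v) (AC w v u).
by move: (A u v w) (A u w v) (A v w u) => a b c; field.
Qed.

Lemma tangent_part_dF (a : 'rV[R]_m) (w : 'rV[R]_d) x : O x ->
  (forall v, bil (G (F x)) w ('D_v F x) = bil (h x) a v) ->
  tangent_part h G F x w = 'D_a F x.
Proof.
move=> Ox wa; rewrite (derive_basis a (smooth_differentiable sF Ox)).
apply: mtrace_dual; last by move=> i j; rewrite wa.
  exact: (metric_unitmx posh Ox).
exact: symh.
Qed.

(** By [bil_nabla_dF] the tangential part of nabla_u dF(v) is dF(nabla_u v). This links the mean
    curvature, defined by projection, to the tension field. *)
Lemma second_fund_hess x u v : O x -> second_fund h G F x u v = hess_map h G F x u v.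
Proof.
move=> Ox; rewrite /second_fund /hess_map nabla_cst; congr (_ - _).
by apply: (tangent_part_dF Ox) => w; exact: bil_nabla_dF.
Qed.

Lemma mean_curv_tension x : O x -> mean_curv h G F x = m%:R^-1 *: tension h G F x.
Proof.
move=> Ox; rewrite /mean_curv /tension /mtrace; congr (_ *: _).
by apply: eq_bigr => i _; apply: eq_bigr => j _; rewrite second_fund_hess.
Qed.

Lemma bil_mtrace (A : 'M[R]_d) (H : 'M[R]_m) T w :
  bil A (mtrace H T) w = mtrace H (fun u v => bil A (T u v) w : R^o).
Proof.
rewrite /mtrace bil_suml; apply: eq_bigr => i _; rewrite bil_suml.
by apply: eq_bigr => j _; rewrite bilZl.
Qed.

Lemma mtrace0 (W : lmodType R) (H : 'M[R]_m) (T : 'rV[R]_m -> 'rV[R]_m -> W) :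
  (forall i j, T (basisv i) (basisv j) = 0) -> mtrace H T = 0.
Proof.
by move=> T0; rewrite /mtrace big1 // => i _; rewrite big1 // => j _; rewrite T0
  scaler0.
Qed.

Lemma hess_normal u v w x : O x -> bil (G (F x)) (hess_map h G F x u v) ('D_w F x) = 0.
Proof.
move=> Ox; rewrite /hess_map nabla_cst bilBl (bil_nabla_dF _ _ _ Ox).
by rewrite -(isometric _ _ Ox) subrr.
Qed.

Lemma tension_normal w x : O x -> bil (G (F x)) (tension h G F x) ('D_w F x) = 0.
Proof.
move=> Ox; rewrite /tension bil_mtrace; apply: mtrace0 => i j.
exact: hess_normal.
Qed.

Lemma smooth_tension : smooth O (tension h G F).
Proof.
have sc a : smooth O (cst a : 'rV[R]_m -> 'rV[R]_m) by exact: smooth_cst.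
have sid := @smooth_id R _ O.
have sinv : smooth O (fun y => invmx (h y)).
  by apply: smooth_invmx => // y Oy; exact: (metric_unitmx posh Oy).
have shess u v : smooth O (fun y => hess_map h G F y u v).
  have sC : smooth O (fun y => christoffel h y u v).
    exact: (smooth_christoffel oO sh symh posh oO sid (fun y Oy => Oy) (sc u) (sc v)).
  (* The direction of this derivative of [F] varies with the point, so it is expanded in the
     basis. *)
  have sD : smooth O (fun y => \sum_k christoffel h y u v 0 k *: 'D_(basisv k) F y).
    apply: smooth_sum => // k; apply: smooth_scale => //; last exact: smooth_derive.
    exact: (smooth_coef 0 k oO sC).
  have s1 := smoothD oO (smooth_nabla_map u (smooth_derive v sF)) (smooth_oppmx oO sD).
  apply: smooth_eq s1 => // y; rewrite inE => Oy; rewrite /hess_map nabla_cst.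
  by rewrite (derive_basis _ (smooth_differentiable sF Oy)).
apply: smooth_sum => // i; apply: smooth_sum => // j.
apply: smooth_scale => //; exact: (smooth_coef i j oO sinv).
Qed.

(** Differentiating |X|^2 = k gives <nabla_w X, X> = 0 for all w, which kills the first-order part
    of the Hessian; differentiating <nabla_v X, X> = 0 along [u] gives the rest. *)
Lemma hess_along_const_norm (X : 'rV[R]_m -> 'rV[R]_d) (k : R) x u v : smooth O X ->
  (forall y, O y -> bil (G (F y)) (X y) (X y) = k) -> O x ->
  bil (G (F x)) (hess_along h G F X x u v) (X x) =
  - bil (G (F x)) (nabla_along G F u X x) (nabla_along G F v X x).
Proof.
move=> sX Xk Ox.
have orth w y : O y -> bil (G (F y)) (nabla_along G F w X y) (X y) = 0.
  move=> Oy; have := derive_inner w Oy sX sX.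
  have E : {in O, (fun y => bil (G (F y)) (X y) (X y)) =1 cst k}.
    by move=> z; rewrite inE => Oz; exact: Xk.
  rewrite (derive_eq_open w oO Oy E) derive_cst (bilC (X y) _ (symG (FO Oy))).
  by move: (bil _ _ _) => a H; lra.
have sN := smooth_nabla_map v sX.
have := derive_inner u Ox sN sX.
have E : {in O, (fun y => bil (G (F y)) (nabla_along G F v X y) (X y)) =1 cst 0}.
  by move=> z; rewrite inE => Oz; exact: orth.
rewrite (derive_eq_open u oO Ox E) derive_cst /hess_along.
move: (orth (nabla h u (cst v) x) x Ox) (symG (FO Ox)).
move: (nabla_along G F u (nabla_along G F v X) x) (X x) (G (F x)).
move: (nabla_along G F (nabla h u (cst v) x) X x).
move: (nabla_along G F u X x) (nabla_along G F v X x) => a b c e y g o sg.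
by rewrite bilBl o (bilC a b sg) subr0; move: (bil g) => f H; lra.
Qed.

Lemma bil_bitension (k : R) x :
  (forall y, O y -> bil (G (F y)) (tension h G F y) (tension h G F y) = k) -> O x ->
  bil (G (F x)) (bitension h G F x) (tension h G F x) =
  mtrace (h x) (fun u v =>
    bil (G (F x)) (curvature G (F x) ('D_u F x) (tension h G F x) (tension h G F x))
      ('D_v F x)
    - bil (G (F x)) (nabla_along G F u (tension h G F) x)
        (nabla_along G F v (tension h G F) x) : R^o).
Proof.
move=> tk Ox; rewrite /bitension /rough_laplacian opprK bilBl !bil_mtrace.
rewrite /mtrace -sumrB; apply: eq_bigr => i _; rewrite -sumrB; apply: eq_bigr => j _.
rewrite -scalerBr; congr (_ *: _).
have H1 := hess_along_const_norm (basisv i) (basisv j) smooth_tension tk Ox.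
(* Skewness rewrites <R(e_i, tau) e_j, tau> as -<R(e_i, tau) tau, e_j>, cancelling the minus sign of
   [bitension]. *)
have H2 := curvature_metric oU sG symG posG ('D_(basisv i) F x) (tension h G F x)
  ('D_(basisv j) F x) (tension h G F x) (FO Ox).
rewrite H1; move: H2 (symG (FO Ox)).
move: (nabla_along G F (basisv i) (tension h G F) x) => a.
move: (nabla_along G F (basisv j) (tension h G F) x) => b.
move: (tension h G F x) ('D_(basisv j) F x) => t e.
move: (curvature G (F x) ('D_(basisv i) F x) t e) => y.
move: (curvature G (F x) ('D_(basisv i) F x) t t) (G (F x)) => z g H2 sg.
by rewrite H2 (bilC e z sg); ring.
Qed.

Lemma mtrace_energy (A : 'M[R]_m) (X : 'rV[R]_m -> 'rV[R]_d) (t : 'rV[R]_d) x :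
  smooth O X -> O x -> A^T *m A = invmx (h x) ->
  mtrace (h x) (fun u v => bil (G (F x)) (curvature G (F x) ('D_u F x) t t) ('D_v F x)
    - bil (G (F x)) (nabla_along G F u X x) (nabla_along G F v X x) : R^o) =
  \sum_k (bil (G (F x)) (curvature G (F x) ('D_(row k A) F x) t t) ('D_(row k A) F x)
    - bil (G (F x)) (nabla_along G F (row k A) X x) (nabla_along G F (row k A) X x)).
Proof.
move=> sX Ox AA; have dF := smooth_differentiable sF Ox.
have [nD nZ] := nabla_along_linear Ox sX.
apply: (@mtrace_frame_forms R m d (h x) A (G (F x)) (fun a => curvature G (F x) a t t)
  (fun u => 'D_u F x) (fun u => nabla_along G F u X x) AA _ _ _ _ nD nZ).
- by move=> a b; exact: (curvatureDl oU sG symG posG _ _ _ _ (FO Ox)).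
- by move=> a b; exact: (curvatureZl oU sG symG posG _ _ _ _ (FO Ox)).
- by move=> u v; exact: (derive_dirD _ _ dF).
- by move=> a u; exact: (derive_dirZ _ _ dF).
Qed.

Lemma nabla_along_eq0 u (X : 'rV[R]_m -> 'rV[R]_d) x : O x ->
  (forall y, O y -> X y = 0) -> nabla_along G F u X x = 0.
Proof.
move=> Ox X0; have E : {in O, X =1 cst 0} by move=> y; rewrite inE => /X0.
rewrite /nabla_along (derive_eq_open u oO Ox E) derive_cst add0r (X0 _ Ox).
rewrite -[X in christoffel _ _ _ X](scale0r 0).
by rewrite (christoffelZr sG posG _ _ _ (FO Ox)) scale0r.
Qed.

(** The tension field is differentiated twice, hence the assumption on all of [O] and not at [x]
    alone. *)
Lemma bitension_eq0 x : (forall y, O y -> tension h G F y = 0) -> O x ->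
  bitension h G F x = 0.
Proof.
move=> t0 Ox; rewrite /bitension /rough_laplacian opprK !mtrace0 ?subr0 //.
- move=> i j; rewrite (t0 _ Ox) -[X in curvature _ _ _ X](scale0r 0).
  by rewrite (curvatureZm oU sG symG posG _ _ _ _ (FO Ox)) scale0r.
- move=> i j; rewrite /hess_along !nabla_along_eq0 ?subr0 // => y Oy.
  exact: nabla_along_eq0.
Qed.

(** * Legendre submanifolds of Sasakian manifolds *)

Section Legendre.
Context (phi : 'rV[R]_d -> 'M[R]_d) (xi : 'rV[R]_d -> 'rV[R]_d).
Context (eta : 'rV[R]_d -> 'cV[R]_d).
Hypotheses (sphi : smooth U phi) (sxi : smooth U xi) (seta : smooth U eta).
Hypothesis phi_sqr : forall x v, U x ->
  v *m phi x *m phi x = - v + pairing (eta x) v *: xi x.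
Hypothesis eta_xi : forall x, U x -> pairing (eta x) (xi x) = 1.
Hypothesis g_phi : forall x u v, U x -> bil (G x) (u *m phi x) (v *m phi x) =
  bil (G x) u v - pairing (eta x) u * pairing (eta x) v.
Hypothesis d_eta : forall x u v, U x ->
  bil (G x) u (v *m phi x) = ext_deriv eta x u v.
Hypothesis sasaki : forall x u v, U x ->
  nabla_endo G phi x u v = bil (G x) u v *: xi x - pairing (eta x) v *: u.
Hypothesis integral : forall x u, O x -> pairing (eta (F x)) ('D_u F x) = 0.

Lemma bil_map_xi x u : O x -> bil (G (F x)) u (xi (F x)) = pairing (eta (F x)) u.
Proof. by move=> Ox; exact: (metric_xi phi_sqr eta_xi g_phi u (FO Ox)). Qed.

(** d eta vanishes on an integral submanifold: differentiating eta(dF v) = 0 along [u] gives the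
    derivative of eta plus eta of a second derivative of [F], and the latter is symmetric, so it
    drops out after antisymmetrising. *)
Lemma dF_phi_dF x u v : O x ->
  bil (G (F x)) ('D_u F x) ('D_v F x *m phi (F x)) = 0.
Proof.
move=> Ox; rewrite (d_eta _ _ (FO Ox)) /ext_deriv.
have alg (a b c : R) : a + c = 0 -> b + c = 0 -> 2^-1 * (a - b) = 0.
  by move=> ac bc; lra.
have H a b : pairing ('D_('D_a F x) eta (F x)) ('D_b F x)
    + pairing (eta (F x)) ('D_a ('D_b F) x) = 0.
  have seF : smooth O (fun y => eta (F y)) by exact: smooth_comp seta sF.
  have := derive_pairing (smooth_derivable (v := a) seF Ox)
    (smooth_derivable (smooth_derive b sF) Ox).
  have E : {in O, (fun y => pairing (eta (F y)) ('D_b F y)) =1 cst 0}.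
    by move=> y; rewrite inE => Oy; exact: integral.
  rewrite (derive_eq_open a oO Ox E) derive_cst.
  rewrite (derive_comp a (smooth_differentiable sF Ox)
    (smooth_differentiable seta (FO Ox))).
  by move=> ->.
have H1 := H u v; have H2 := H v u; move: H1 H2; rewrite (derive_comm u v oO sF Ox).
exact: alg.
Qed.

Lemma nabla_along_xi u x : O x ->
  nabla_along G F u (fun y => xi (F y)) x = - ('D_u F x *m phi (F x)).
Proof.
move=> Ox; rewrite -(nabla_xi oU sG symG posG sphi sxi phi_sqr eta_xi g_phi sasaki _
  (FO Ox)).
rewrite /nabla_along /nabla; congr (_ + _).
exact: derive_comp (smooth_differentiable sF Ox) (smooth_differentiable sxi (FO Ox)).
Qed.

Lemma smooth_map_xi : smooth O (fun y => xi (F y)).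
Proof. exact: smooth_comp sxi sF. Qed.

(** Differentiate g(X, xi) = 0 and use nabla_u xi = -phi dF(u). For X = dF(v) this makes the tension
    horizontal; for X = tau it bounds |nabla tau| from below. *)
Lemma pairing_nabla u X x : O x -> smooth O X ->
  (forall y, O y -> pairing (eta (F y)) (X y) = 0) ->
  pairing (eta (F x)) (nabla_along G F u X x) =
  bil (G (F x)) (X x) ('D_u F x *m phi (F x)).
Proof.
move=> Ox sX X0; have := derive_inner u Ox sX smooth_map_xi.
have E : {in O, (fun y => bil (G (F y)) (X y) (xi (F y))) =1 cst 0}.
  by move=> y; rewrite inE => Oy; rewrite (bil_map_xi _ Oy) X0.
rewrite (derive_eq_open u oO Ox E) derive_cst (nabla_along_xi _ Ox).
rewrite (bil_map_xi _ Ox) bilNr.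
by move: (pairing _ _) (bil _ _ _) => a b H; lra.
Qed.

Lemma tension_horizontal x : O x -> pairing (eta (F x)) (tension h G F x) = 0.
Proof.
move=> Ox; rewrite -(bil_map_xi _ Ox) /tension bil_mtrace; apply: mtrace0 => i j.
rewrite (bil_map_xi _ Ox) /hess_map /nabla_along -/(nabla_along _ _ _ _ _).
rewrite pairingD pairingN (integral _ Ox) subr0.
rewrite (pairing_nabla _ Ox (smooth_derive _ sF)) ?dF_phi_dF // => y Oy.
exact: integral.
Qed.

Hypothesis dim_d : d = (m + m).+1.

(* At a point of a Legendre submanifold the tangent space splits orthogonally
   into [L + phi L + R xi]. *)
Lemma legendre_normal x w : O x -> (forall u, bil (G (F x)) w ('D_u F x) = 0) ->
  pairing (eta (F x)) w = 0 -> exists z, w = 'D_z F x *m phi (F x).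
Proof.
move=> Ox wF w0; have UFx := FO Ox; have dF := smooth_differentiable sF Ox.
pose J : 'M[R]_(m, d) := \matrix_i 'D_(basisv i) F x.
have DJ a : 'D_a F x = a *m J.
  by rewrite (derive_basis a dF) mulmx_sum_row; apply: eq_bigr => i _; rewrite rowK.
pose P := phi (F x).
(* The m + (m + 1) = d rows are the coordinate frames of TM and phi TM, followed by xi; they are
   shown to be a basis. *)
pose K := col_mx J (col_mx (J *m P) (xi (F x))).
have comb (a b : 'rV[R]_m) (c : 'rV[R]_1) : row_mx a (row_mx b c) *m K =
    'D_a F x + 'D_b F x *m P + c 0 0 *: xi (F x).
  by rewrite !mul_row_col !DJ mulmxA addrA {1}[c]mx11_scalar mul_scalar_mx.
(* [g1] and [g2] read off the coefficients on TM and on xi. They serve twice: for independence, and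
   to see that [w] has only a phi TM component. *)
have g1 a b u c : bil (G (F x)) ('D_a F x + 'D_b F x *m P + c *: xi (F x)) ('D_u F x)
    = bil (h x) a u.
  rewrite !bilDl bilZl (bilC (xi (F x)) _ (symG UFx)) (bil_map_xi _ Ox) (integral _ Ox).
  rewrite (bilC ('D_b F x *m P) _ (symG UFx)) (dF_phi_dF _ _ Ox) mulr0 !addr0.
  by rewrite -(isometric _ _ Ox).
have g2 a b c : pairing (eta (F x)) ('D_a F x + 'D_b F x *m P + c *: xi (F x)) = c.
  rewrite !pairingD pairingZ (integral _ Ox) (eta_xi UFx) mulr1 add0r.
  by rewrite (eta_phi (fun v => phi_sqr v UFx) (eta_xi UFx)) add0r.
have split3 (v : 'rV[R]_(m + (m + 1))) : exists a b c, v = row_mx a (row_mx b c).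
  exists (lsubmx v), (lsubmx (rsubmx v)), (rsubmx (rsubmx v)).
  by rewrite !hsubmxK.
have hinj a : bil (h x) a a = 0 -> a = 0 by exact: (bil_eq0 posh Ox).
have freeK : row_free K.
  rewrite -kermx_eq0; apply/eqP/row_matrixP => i; rewrite row0.
  have /sub_kermxP : (row i (kermx K) <= kermx K)%MS by exact: row_sub.
  have [a [b [c ->]]] := split3 (row i (kermx K)); rewrite comb => E.
  have c0 : c 0 0 = 0 by rewrite -(g2 a b (c 0 0)) E /pairing mul0mx mxE.
  have a0 : a = 0 by apply: hinj; rewrite -(g1 a b a (c 0 0)) E bil0l.
  move: E; rewrite a0 c0 derive0 add0r scale0r addr0 => E.
  have b0 : b = 0.
    apply: hinj; rewrite (isometric _ _ Ox).
    have := g_phi ('D_b F x) ('D_b F x) UFx.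
    by rewrite (integral _ Ox) mulr0 subr0 => <-; rewrite -/P E bil0l.
  by rewrite b0 [c]mx11_scalar c0 raddf0 !row_mx0.
have fullK : row_full K.
  by move: freeK; rewrite /row_free /row_full => /eqP ->; rewrite addnA addn1 -dim_d.
have /submxP[D wD] := submx_full w fullK.
have [a [b [c Dabc]]] := split3 D; have E := wD; rewrite Dabc comb in E.
have c0 : c 0 0 = 0 by rewrite -(g2 a b (c 0 0)) -E.
have a0 : a = 0 by apply: hinj; rewrite -(g1 a b a (c 0 0)) -E.
by exists b; rewrite E a0 c0 derive0 add0r scale0r addr0.
Qed.

Context (c : R).
Hypothesis phi_sectional : forall x u, U x ->
  bil (G x) u u = 1 -> bil (G x) u (xi x) = 0 -> sectional G x u (u *m phi x) = c.
Hypothesis c_le : c * (m%:R + 3) <= 3 - 3 * m%:R.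

Lemma tension_eq0 (k : R) x :
  (forall y, O y -> bil (G (F y)) (tension h G F y) (tension h G F y) = k) -> O x ->
  bitension h G F x = 0 -> tension h G F x = 0.
Proof.
move=> tk Ox b0; have UFx := FO Ox.
have [z tz] := legendre_normal Ox (fun u => tension_normal u Ox) (tension_horizontal
  Ox).
have [A [AhA AA]] := orthonormal_frame (symh Ox) (fun u => posh (u := u) Ox).
pose q := bil (h x) z z.
have q0 : 0 <= q by exact: (bil_ge0 posh).
pose p i := bil (h x) (row i A) z.
pose N i := nabla_along G F (row i A) (tension h G F) x.
pose T i := curvature G (F x) ('D_(row i A) F x) (tension h G F x) (tension h G F x).
have sumTN : \sum_i (bil (G (F x)) (T i) ('D_(row i A) F x) - bil (G (F x)) (N i) (N
  i)) = 0.
  rewrite -(mtrace_energy (tension h G F x) smooth_tension Ox AA).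
  by rewrite -(bil_bitension tk Ox) b0 bil0l.
(* Here tau = phi dF(z), so the formula applies to u = dF(e_i) and v = dF(z); isometry brings the
   inner products back to [h], where e_i is a unit vector. *)
have TE i : 4 * bil (G (F x)) (T i) ('D_(row i A) F x)
    = (c + 3) * q + 3 * (c - 1) * p i ^+ 2.
  rewrite /T tz (bil_curvature_lagrangian oU sG symG posG sphi sxi phi_sqr eta_xi g_phi
    sasaki phi_sectional UFx (integral _ Ox) (integral _ Ox) (dF_phi_dF _ _ Ox)).
  by rewrite -!(isometric _ _ Ox) (frame_unit i AhA) mulr1.
(* |nabla_i tau|^2 >= eta(nabla_i tau)^2, and eta(nabla_i tau) = h(z, e_i). *)
have NE i : p i ^+ 2 <= bil (G (F x)) (N i) (N i).
  have := bil_ge0 posG (N i *m phi (F x)) UFx; rewrite (g_phi _ _ UFx).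
  have -> : pairing (eta (F x)) (N i) = p i.
    rewrite /N (pairing_nabla _ Ox smooth_tension tension_horizontal) tz.
    rewrite (g_phi _ _ UFx) (integral _ Ox) mul0r subr0 -(isometric _ _ Ox).
    exact: bilC (symh Ox).
  by rewrite subr_ge0 expr2.
have parseval : \sum_i p i ^+ 2 = q.
  exact: frame_parseval (metric_unitmx posh Ox) (symh Ox) AA.
(* The sum over the frame, multiplied by 4: the coefficient of [Q] is c (M + 3) + 3 M - 3 from the
   curvature, which is nonpositive, and -4 from the xi-components. *)
have arith (M Q : R) : c * (M + 3) <= 3 - 3 * M -> 0 <= Q ->
    0 <= M * ((c + 3) * Q) + (3 * (c - 1) - 4) * Q -> Q <= 0.
  move=> cM Q0; have : 0 <= (3 - 3 * M - c * (M + 3)) * Q by rewrite mulr_ge0 ?subr_ge0.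
  by move=> *; lra.
have q_le0 : q <= 0.
  have : 0 <= \sum_i ((c + 3) * q + (3 * (c - 1) - 4) * p i ^+ 2).
    have E : 0 = \sum_i 4 * (bil (G (F x)) (T i) ('D_(row i A) F x)
        - bil (G (F x)) (N i) (N i)) by rewrite -mulr_sumr sumTN mulr0.
    rewrite [X in X <= _]E; apply: ler_sum => i _; rewrite mulrBr TE.
    move: (NE i); move: (bil _ (N i) _) (p i ^+ 2) => a b; lra.
  rewrite big_split /= sumr_const card_ord -mulr_sumr parseval -[_ *+ m]mulr_natl.
  exact: arith.
have z0 : z = 0.
  by apply: (bil_eq0 posh Ox); apply/eqP; rewrite eq_le q_le0 q0.
by rewrite tz z0 derive0 mul0mx.
Qed.

End Legendre.
End Immersion.

(** * Manifolds *)

Section ChartDomains.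
Context {R : realType} {m d : nat} {M : manifold R m} {N : manifold R d}.
Context (f : M -> N) (a : chart M) (b : chart N).

Lemma map_domE x : map_dom f a b x <-> chart_img a x /\ dom b (f (param a x)).
Proof.
split=> [[p [ap bp] <-]|[[p ap <-]]].
  by rewrite coordK //; split=> //; exists p.
by rewrite coordK // => bp; exists p.
Qed.

Lemma map_dom_chart_img x : map_dom f a b x -> chart_img a x.
Proof. by case/map_domE. Qed.

Lemma map_coord_chart_img x : map_dom f a b x -> chart_img b (map_coord f a b x).
Proof. by case/map_domE => _ bx; exists (f (param a x)). Qed.

(** [param a] is a total function, continuous only at points of the chart image; hence the argument
    by neighbourhoods. *)
Lemma map_dom_open : continuous f -> open (map_dom f a b).
Proof.
move=> cf; rewrite openE => x /[dup] Ox /map_domE[ax bx].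
have n1 : \forall y \near x, chart_img a y.
  by apply: open_nbhs_nbhs; split => //; exact: coord_open.
have n2 : \forall y \near x, dom b (f (param a y)).
  apply: (@param_continuous _ _ M a x ax (f @^-1` dom b)).
  by apply: cf; apply: open_nbhs_nbhs; split => //; exact: dom_open.
by apply: filterS2 n1 n2 => y ay byy; apply/map_domE.
Qed.

End ChartDomains.

Lemma smooth_on_subset (R : realType) (d : nat) (W : normedModType R)
    (U U' : set 'rV[R]_d) (f : 'rV[R]_d -> W) :
  U' `<=` U -> smooth_on U f -> smooth_on U' f.
Proof. by move=> UU sf s x /UU; exact: sf. Qed.

Theorem corollary3p2 (R : realType) (n : nat) (n_gt0 : (0 < n)%N)
    (N : manifold R (2 * n).+1) (S : contact_metric N) (c : R)
    (space_form : sasakian_space_form S c)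
    (c_le : c <= (3 - 3 * n%:R) / (n%:R + 3))
    (M : manifold R n) (h : riemannian_metric M) (f : M -> N)
    (f_integral : integral_submanifold S f)
    (h_induced : induced_metric h (cmetric S) f)
    (cmc : constant_mean_curvature h (cmetric S) f) :
  biharmonic h (cmetric S) f <-> minimal h (cmetric S) f.
Proof.
have [[[cf sf] _ _] intf] := f_integral.
have [sas phisec] := space_form.
have n3 : 0 < n%:R + 3 :> R by rewrite ltr_wpDl.
have {}c_le : c * (n%:R + 3) <= 3 - 3 * n%:R by rewrite -ler_pdivlMr.
(* With n nonzero the factor 1/n of [mean_curv] is a true inverse, so H and tau vanish together. *)
have n0 : n%:R != 0 :> R by rewrite pnatr_eq0 -lt0n.
have dimE : (2 * n).+1 = (n + n).+1 by rewrite mul2n addnn.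
have [k kE] := cmc.
(* The two implications localise differently: a zero bitension at [x] needs H = 0 on the whole chart
   domain, whereas the converse uses the biharmonic equation at [x] alone. *)
suff H a b x : map_dom f a b x ->
  ((forall y, map_dom f a b y ->
     mean_curv (h a) (cmetric S b) (map_coord f a b) y = 0) ->
   bitension (h a) (cmetric S b) (map_coord f a b) x = 0) /\
  (bitension (h a) (cmetric S b) (map_coord f a b) x = 0 ->
   mean_curv (h a) (cmetric S b) (map_coord f a b) x = 0).
  split=> Hf a b x Ox; first exact: (H a b x Ox).2 (Hf a b x Ox).
  by apply: (H a b x Ox).1 => y Oy; exact: Hf.
move=> Ox.
pose O := map_dom f a b; pose U := chart_img b; pose F := map_coord f a b.
have oO : open O := map_dom_open cf.
have oU : open U by exact: coord_open.
have sG : smooth U (cmetric S b).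
  by apply: smooth_on_smooth oU _; exact: metric_smooth.
have sphi : smooth U (cphi S b) by apply: smooth_on_smooth oU _; exact: cphi_smooth.
have sxi : smooth U (cxi S b) by apply: smooth_on_smooth oU _; exact: cxi_smooth.
have seta : smooth U (ceta S b) by apply: smooth_on_smooth oU _; exact: ceta_smooth.
have sF : smooth O F := smooth_on_smooth oO (sf a b).
have sh : smooth O (h a).
  apply: smooth_on_smooth oO _; apply: smooth_on_subset (@metric_smooth _ _ _ h a).
  exact: map_dom_chart_img.
have symh y (Oy : O y) := Defs.metric_sym h (map_dom_chart_img Oy).
have posh y u (Oy : O y) := @metric_pos _ _ _ h a y u (map_dom_chart_img Oy).
have symG y (Uy : U y) := Defs.metric_sym (cmetric S) Uy.
have posG y u (Uy : U y) := @metric_pos _ _ _ (cmetric S) b y u Uy.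
have FO y (Oy : O y) : U (F y) := map_coord_chart_img Oy.
have iso y u v (Oy : O y) := @h_induced a b y u v Oy.
have mcE y (Oy : O y) := mean_curv_tension oU sG symG posG oO sh symh posh sF FO iso Oy.
have tE y : O y -> tension (h a) (cmetric S b) F y =
    n%:R *: mean_curv (h a) (cmetric S b) F y.
  by move=> Oy; rewrite mcE // scalerA mulfV // scale1r.
split=> [mc0|b0].
  have t0 y : O y -> tension (h a) (cmetric S b) F y = 0.
    by move=> Oy; rewrite tE // mc0 // scaler0.
  exact: (bitension_eq0 oU sG symG posG oO FO t0 Ox).
rewrite mcE //.
(* Constancy of |H| gives |tau|^2 = n^2 k^2; nonnegativity of the form is what lets the square root
   be squared away. *)
have tk y : O y -> bil (cmetric S b (F y)) (tension (h a) (cmetric S b) F y)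
    (tension (h a) (cmetric S b) F y) = n%:R * (n%:R * k ^+ 2).
  move=> Oy; rewrite tE // bilZl bilZr -(kE a b y Oy) sqr_sqrtr //.
  exact: (bil_ge0 posG _ (FO _ Oy)).
have pS y v (Uy : U y) := cphi_sqr S v Uy.
have eS y (Uy : U y) := ceta_xi S Uy.
have gS y u v (Uy : U y) := cmetric_phi S u v Uy.
have dS y u v (Uy : U y) := cmetric_deta S u v Uy.
have nS y u v (Uy : U y) := sas b y u v Uy.
have iS y u (Oy : O y) := intf a b y u Oy.
have cS y u (Uy : U y) := phisec b y u Uy.
rewrite (tension_eq0 oU sG symG posG oO sh symh posh sF FO iso sphi sxi seta
  pS eS gS dS nS iS dimE cS c_le tk Ox b0).
exact: scaler0.
Qed.
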